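(* Let $a,b,s$ be positive integers and consider the urn with replacement matrix $\begin{pmatrix} -a & a+s \\ b+s & -b \end{pmatrix}$, started with $a_0$ black and $b_0$ white balls, $t_0:=a_0+b_0\ge 1$, and assume the urn is tenable. Let $X_n$ be the number of black balls at time $n$ and let $p_n(u)=\mathbb{E}(u^{X_n})$ be its probability generating function. Then for all $n\ge 0$ $$p_n(u)=\frac{\Gamma(n+1)\,\Gamma(t_0/s)}{s^n\,\Gamma(n+t_0/s)}\,[z^n]H(z,u),$$ where the bivariate generating function $H(z,u)$ is given by $$H(z,u)=\delta(u)^{t_0}\,\psi\bigl(z\,\delta(u)^s+I(u)\bigr),$$ with $$\delta(u):=(1-u^h)^{1/h},\qquad I(u):=\int_0^u\frac{t^{a-1}}{\delta(t)^{a+b}}\,dt,\qquad h:=a+b+s,$$ and the function $\psi$ is defined implicitly by $$\psi(I(u))=\frac{u^{a_0}}{\delta(u)^{t_0}}.$$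
   Context: Urn process: the urn contains black and white balls. At each time step a ball is drawn uniformly at random from the urn, its color is observed and it is put back. If it is black, $a$ black balls are removed and $a+s$ white balls are added; if it is white, $b+s$ black balls are added and $b$ white balls are removed. (First row of the matrix: changes when black is drawn; second row: when white is drawn; first column: black, second column: white.) At time $n$ the urn contains exactly $t_0+sn$ balls. Tenability means: $a$ divides $a_0$, $b$ divides $b_0$, $a$ divides $b+s$, and $b$ divides $a+s$. $[z^n]f$ denotes the coefficient of $z^n$ in the power series $f$. The bivariate generating function of the urn is $H(z,u)=\sum_{n\ge0}h_n(u)z^n/n!$, where $h_n(u)=\sum_k h_{n,k}u^k$ and $h_{n,k}$ is the number of evolution histories of length $n$ (all balls being considered distinguishable, a history being the sequence of $n$ choices of balls) ending with $k$ black balls. The branch of $\delta$ is the one with $\delta(0)=1$, and $\psi$ is the function analytic near $0$ satisfying the implicit equation for $u$ near $0$. *)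

(* Defs.v *)
(* Stdlib's R is used throughout; through Rstruct it is the realType of the
   probability space, and Coquelicot supplies the complex analysis. *)
From HB Require Import structures.
From mathcomp Require Import all_boot all_order all_algebra.
From mathcomp Require Import all_classical all_reals all_analysis.
From mathcomp Require Import Rstruct Rstruct_topology.
From Stdlib Require Import Reals.
From Coquelicot Require Import Coquelicot.

Set Implicit Arguments.
Unset Strict Implicit.
Unset Printing Implicit Defensive.

Section Urn.
Local Open Scope nat_scope.

(* A composition of the urn is a pair (black, white). *)
Implicit Types (st : nat * nat) (w : seq nat).

Definition balls st : nat := st.1 + st.2.

(* The balls present are numbered 0, ..., balls st - 1, black ones first.
   In a tenable urn, a divides the number of black balls and b the number of white
   balls at all times, so these subtractions are never truncated. *)
Definition urn_step (a b s : nat) st (i : nat) : nat * nat :=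
  if i < st.1 then (st.1 - a, st.2 + (a + s)) else (st.1 + (b + s), st.2 - b).

Definition urn_state (a b s : nat) st w : nat * nat := foldl (urn_step a b s) st w.

(* All sequences of n successive choices of balls, without repetition. *)
Fixpoint histories (a b s : nat) st (n : nat) : seq (seq nat) :=
  if n is n'.+1 then
    [seq i :: w | i <- seq.iota 0 (balls st), w <- histories a b s (urn_step a b s st i) n']
  else [:: [::]].

Definition nb_histories (a b s : nat) st (n k : nat) : nat :=
  count (fun w => (urn_state a b s st w).1 == k) (histories a b s st n).

Definition tenable (a b s a0 b0 : nat) : bool :=
  [&& a %| a0, b %| b0, a %| b + s & b %| a + s].

End Urn.

Section Process.
Variables (d : measure_display) (Omega : measurableType d) (P : probability Omega R).
Variables (a b s : nat) (st : nat * nat).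
Implicit Type D : nat -> {RV P >-> nat}.

Definition draws D (n : nat) (omega : Omega) : seq nat :=
  mkseq (fun k => D k omega) n.

(* Given the first n draws, the next ball is uniform among those in the urn. *)
Definition uniform_draws D : Prop :=
  forall (n : nat) (w : seq nat) (i : nat),
    w \in histories a b s st n ->
    (i < balls (urn_state a b s st w))%nat ->
    fine (P [set omega | draws D n.+1 omega = rcons w i]%classic) =
    Rdiv (fine (P [set omega | draws D n omega = w]%classic))
         (INR (balls (urn_state a b s st w))).

Definition nb_black D (n : nat) (omega : Omega) : nat :=
  (urn_state a b s st (draws D n omega)).1.

(* Complex-valued expectation, componentwise. *)
Definition pgf D (n : nat) (u : C) : C :=
  (fine (expectation P (fun omega => Re (Cpow u (nb_black D n omega)) : R)),
   fine (expectation P (fun omega => Im (Cpow u (nb_black D n omega)) : R))).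

End Process.

Section Analysis.
Local Open Scope R_scope.

Definition Gamma (x : R) : R :=
  RInt_gen (fun t => Rpower t (x - 1) * exp (- t)) (at_right 0) (Rbar_locally p_infty).

(* Principal h-th root, on the half-plane 0 < Re w. *)
Definition Croot (h : nat) (w : C) : C :=
  let theta := atan (Im w / Re w) / INR h in
  (RtoC (Rpower (Cmod w) (/ INR h)) * (cos theta, sin theta))%C.

(* For 0 < h and Cmod u < 1 one has 0 < Re (1 - u ^ h): on the unit disc this is
   the continuous branch with delta 0 = 1. *)
Definition delta (a b s : nat) (u : C) : C :=
  let h := (a + b + s)%nat in Croot h (1 - Cpow u h)%C.

(* Complex integral along the segment t = x u, 0 <= x <= 1. *)
Definition Iint (a b s : nat) (u : C) : C :=
  RInt (V := C_R_CompleteNormedModule)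
    (fun x : R =>
       let t := (RtoC x * u)%C in
       (u * (Cpow t (a - 1)%nat / Cpow (delta a b s t) (a + b)%nat))%C) 0 1.

Definition analytic_near0 (f : C -> C) : Prop :=
  exists (c : nat -> C) (r : R), 0 < r /\
    forall w : C, Cmod w < r -> @is_pseries C_AbsRing C_NormedModule c w (f w).

Definition is_psi (a b s a0 b0 : nat) (psi : C -> C) : Prop :=
  analytic_near0 psi /\
  exists r : R, 0 < r /\
    forall u : C, Cmod u < r ->
      psi (Iint a b s u) = (Cpow u a0 / Cpow (delta a b s u) (a0 + b0)%nat)%C.

(* The number of black balls after n steps is at most a0 + b0 + s * n. *)
Definition history_poly (a b s a0 b0 n : nat) (u : C) : C :=
  sum_n (G := C_AbelianGroup)
    (fun k => (RtoC (INR (nb_histories a b s (a0, b0) n k)) * Cpow u k)%C)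
    (a0 + b0 + s * n)%nat.

(* H(z,u), as a power series in z: the sequence of its coefficients [z^n] H(z,u). *)
Definition urn_bgf (a b s a0 b0 : nat) (u : C) : nat -> C :=
  fun n => (history_poly a b s a0 b0 n u / RtoC (INR n`!))%C.

End Analysis.

(* Main.v *)
Require Import Defs.
From HB Require Import structures.
From mathcomp Require Import all_boot all_order all_algebra.
From mathcomp Require Import all_classical all_reals all_analysis.
From mathcomp Require Import Rstruct Rstruct_topology.
From mathcomp Require Import measurable_realfun zify.
From Stdlib Require Import Reals Lra Lia.
From Coquelicot Require Import Coquelicot.

Set Implicit Arguments.
Unset Strict Implicit.
Unset Printing Implicit Defensive.


(** Let h_n(u) be the sum of u^(final number of black balls) over the histories of length
    n ([history_sum]), and A_n(u) = h_n(u) / delta(u)^(t0 + s n) ([flow_coef]).  Everything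
    about H rests on the identity A_n' = I' A_{n+1} ([flow_coef_derive]): in the variable
    I(u), each A_n is the derivative of the preceding one, starting from
    A_0(u) = u^a0 / delta(u)^t0, which is psi(I(u)).  So A_n(u) is the n-th derivative of psi
    at I(u), and delta(u)^t0 psi(I(u) + z delta(u)^s) = H(z, u) is a Taylor expansion.  For
    n = 0 the identity is a computation with delta^h = 1 - u^h ([flow_base_identity]); it
    passes from n to n + 1 because splitting histories according to the first ball writes
    A_{n+1} as a combination, with constant coefficients, of the A_n of the two urns which
    that ball may produce ([flow_coefS]).

    Inverting I is avoided: psi is defined by the series sum h_n(0) w^n / n!, which is what
    H(z, u) must be at u = 0.  For fixed u and c, the Taylor sums
    sum_{n <= N} A_n(x u) (c - I(x u))^n / n! have a telescoping derivative in the real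
    variable x, namely I' A_{N+1} (c - I)^N / N! ([flow_taylor_derive]).  There are at most
    (t0 + s)^n n! histories of length n, so this derivative tends to 0 geometrically when u
    and c are small, and the sums at x = 0 and x = 1 have the same limit ([flow_series]).
    At x = 0 they are the partial sums of psi(c); at x = 1 and c = z delta(u)^s + I(u) they
    are those of H(z, u) / delta(u)^t0.  The case z = 0 is the implicit equation
    ([flow_psi_exists]).  Any other solution takes the same values at the points I(u), which
    are nonzero and accumulate at 0, so it has the same power series ([is_psi_unique]).

    On the side of probability, the total number of balls after n steps is t0 + s n whatever
    is drawn, so all histories of length n are equally likely ([prob_draws]), and p_n(u) is
    h_n(u) divided by the number prod_{j < n} (t0 + s j) of histories ([pgfE]).  The
    functional equation of Gamma turns this product into the stated quotient
    ([Gamma_rising]). *)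

(** * Histories of the urn *)

(** Divisibility makes the removals exact: a ball of some colour can be drawn only if at
    least a (or b) of them are present, so that the total really grows by s. *)
Lemma tenable_step (a b s : nat) (st : nat * nat) (i : nat) :
  tenable a b s st.1 st.2 -> (i < balls st)%nat ->
  let st' := urn_step a b s st i in
  tenable a b s st'.1 st'.2 /\ balls st' = (balls st + s)%nat.
Proof.
case: st => k l /and4P[/= ak bl abs bas]; rewrite /balls /urn_step /= => i_lt.
case: ltnP => [ik|ki] /=.
  have a_le_k : (a <= k)%nat by apply: dvdn_leq => //; apply: leq_ltn_trans ik.
  split; last by lia.
  by apply/and4P; split=> //; [apply: dvdn_sub | apply: dvdn_add].
have l_gt0 : (0 < l)%nat by rewrite -(ltn_add2l k) addn0; apply: leq_ltn_trans i_lt.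
have b_le_l : (b <= l)%nat by apply: dvdn_leq.
split; last by lia.
by apply/and4P; split=> //; [apply: dvdn_add | apply: dvdn_sub].
Qed.

Lemma histories_rcons (a b s : nat) (n : nat) (st : nat * nat) (w : seq nat) :
  w \in histories a b s st n.+1 ->
  exists v i, [/\ w = rcons v i, v \in histories a b s st n
                & (i < balls (urn_state a b s st v))%nat].
Proof.
elim: n st w => [|n IHn] st w; move=> /allpairsPdep [i [v []]].
  by rewrite mem_iota add0n inE => i_lt /eqP -> ->; exists [::], i.
move=> i_lt v_in ->{w}.
have [v' [j [-> v'_in j_lt]]] := IHn _ _ v_in.
exists (i :: v'), j; split=> //; apply/allpairsPdep.
by exists i, v'.
Qed.

Lemma tenable_histories (a b s : nat) (n : nat) (st : nat * nat) (w : seq nat) :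
  tenable a b s st.1 st.2 -> w \in histories a b s st n ->
  balls (urn_state a b s st w) = (balls st + s * n)%nat.
Proof.
elim: n st w => [|n IHn] st w ten_st.
  by rewrite inE => /eqP ->; rewrite muln0 addn0.
move=> /allpairsPdep [i [v []]]; rewrite mem_iota add0n => i_lt v_in ->{w}.
have [ten' bal'] := tenable_step ten_st i_lt.
by rewrite [urn_state _ _ _ _ _]/(urn_state _ _ _ _ v) (IHn _ _ ten' v_in) bal' mulnS addnA.
Qed.

Lemma histories_uniq (a b s : nat) (n : nat) (st : nat * nat) :
  uniq (histories a b s st n).
Proof.
elim: n st => [//|n IHn] st; apply: allpairs_uniq_dep => [|i _|]; first exact: iota_uniq.
  exact: IHn.
by move=> [i v] [j w] _ _ [-> ->].
Qed.

(** The number of choices at step j is t + s j, independently of the earlier draws. *)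
Lemma size_histories (a b s : nat) (n : nat) (st : nat * nat) :
  tenable a b s st.1 st.2 ->
  size (histories a b s st n) = (\prod_(j < n) (balls st + s * j))%nat.
Proof.
elim: n st => [|n IHn] st ten_st; first by rewrite big_ord0.
rewrite /= size_allpairs_dep sumnE big_map.
transitivity (\sum_(i <- seq.iota 0 (balls st)) \prod_(j < n) (balls st + s + s * j))%nat.
  apply: eq_big_seq => i; rewrite mem_iota add0n => i_lt.
  by have [ten' bal'] := tenable_step ten_st i_lt; rewrite IHn // bal'.
rewrite big_const_seq iter_addn_0 count_predT size_iota mulnC big_ord_recl muln0 addn0; congr muln.
by apply: eq_bigr => j _; rewrite lift0 mulnS addnA.
Qed.

Section HistorySum.
Local Open Scope R_scope.

HB.instance Definition _ :=
  Monoid.isComLaw.Build C (RtoC 0) Cplus Cplus_assoc Cplus_comm Cplus_0_l.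

(** The polynomial h_n, summed over histories instead of over the number of black balls, so
    that recurrences on histories apply to it directly. *)
Definition history_sum (a b s : nat) (st : nat * nat) (n : nat) (u : C) : C :=
  \big[Cplus/RtoC 0]_(w <- histories a b s st n) Cpow u (urn_state a b s st w).1.

Lemma big_Cplus_const (I : eqType) (r : seq I) (c : C) :
  \big[Cplus/RtoC 0]_(i <- r) c = Cmult (INR (size r)) c.
Proof.
elim: r => [|i r IHr]; first by rewrite big_nil /= Cmult_0_l.
by rewrite big_cons IHr -[size (i :: r)]/(size r).+1 S_INR RtoC_plus; ring.
Qed.

(** Histories are split according to the first ball drawn. *)
Lemma history_sumS (a b s : nat) (st : nat * nat) (n : nat) (u : C) :
  history_sum a b s st n.+1 u =
  Cplus (Cmult (INR st.1) (history_sum a b s (st.1 - a, st.2 + (a + s))%nat n u))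
        (Cmult (INR st.2) (history_sum a b s (st.1 + (b + s), st.2 - b)%nat n u)).
Proof.
rewrite /history_sum /= big_allpairs_dep /=.
rewrite [seq.iota _ _](iotaD 0 st.1 st.2) big_cat /=; congr Cplus.
  rewrite -[X in INR X](size_iota 0) -big_Cplus_const.
  apply: eq_big_seq => i; rewrite mem_iota add0n => /= i_lt.
  by rewrite /urn_step i_lt.
rewrite -[X in INR X](size_iota st.1) add0n -big_Cplus_const.
apply: eq_big_seq => i; rewrite mem_iota => /andP[i_ge _].
by rewrite /urn_step ltnNge i_ge.
Qed.

Lemma sum_n_single (c : C) (m N : nat) :
  sum_n (G := C_AbelianGroup) (fun k => Cmult (INR (m == k)) (Cpow c k)) N =
  if (m <= N)%nat then Cpow c m else RtoC 0.
Proof.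
elim: N => [|N IHN].
  by rewrite sum_O leqn0; case: eqP => [->|_] /=; ring.
rewrite sum_Sn IHN (leq_eqVlt m N.+1) ltnS /plus /=; case: eqP => [->|_] /=.
  by rewrite ltnn; ring.
by case: leqP => _; ring.
Qed.

Lemma sum_n_count (T : Type) (f : T -> nat) (l : seq T) (c : C) (N : nat) :
  all (fun x => f x <= N)%nat l ->
  sum_n (G := C_AbelianGroup)
    (fun k => Cmult (INR (count (fun x => f x == k) l)) (Cpow c k)) N =
  \big[Cplus/RtoC 0]_(x <- l) Cpow c (f x).
Proof.
elim: l => [_|x l IHl /= /andP[fx_le /IHl {IHl} IHl]].
  rewrite big_nil (sum_n_ext _ (fun=> zero)) => [|k].
    by elim: N => [|N IHN]; rewrite ?sum_O // sum_Sn IHN plus_zero_l.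
  by rewrite /= Cmult_0_l.
rewrite big_cons -IHl.
transitivity (plus (sum_n (G := C_AbelianGroup) (fun k => Cmult (INR (f x == k)) (Cpow c k)) N)
  (sum_n (G := C_AbelianGroup)
    (fun k => Cmult (INR (count (fun x => f x == k) l)) (Cpow c k)) N)).
  rewrite -sum_n_plus; apply: sum_n_ext => k.
  by rewrite plus_INR RtoC_plus /plus /=; ring.
by rewrite sum_n_single fx_le.
Qed.

Lemma history_polyE (a b s a0 b0 n : nat) (u : C) :
  tenable a b s a0 b0 ->
  history_poly a b s a0 b0 n u = history_sum a b s (a0, b0) n u.
Proof.
move=> ten; apply: sum_n_count; apply/allP => w w_in.
have := tenable_histories (st := (a0, b0)) ten w_in.
by rewrite /balls /= => <-; apply: leq_addr.
Qed.

Lemma Cmod_history_sum (a b s : nat) (st : nat * nat) (n : nat) (u : C) :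
  (Cmod u <= 1)%R ->
  (Cmod (history_sum a b s st n u) <= INR (size (histories a b s st n)))%R.
Proof.
move=> u_le1; rewrite /history_sum.
elim: (histories _ _ _ _ _) => [|w r IHr]; first by rewrite big_nil Cmod_0; apply: Rle_refl.
rewrite big_cons -[size (w :: r)]/(size r).+1 S_INR; apply: Rle_trans (Cmod_triangle _ _) _.
rewrite Rplus_comm; apply: Rplus_le_compat IHr _.
rewrite Cmod_pow -(pow1 (urn_state a b s st w).1).
by apply: pow_incr; split; first exact: Cmod_ge_0.
Qed.

(** The bound that makes both psi and H converge: after division by n! it is geometric. *)
Lemma size_histories_le (a b s : nat) (st : nat * nat) n : tenable a b s st.1 st.2 ->
  INR (size (histories a b s st n)) <= INR (balls st + s) ^ n * INR n`!.
Proof.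
move=> /size_histories ->; elim: n => [|n IHn]; first by rewrite big_ord0 /=; lra.
rewrite big_ord_recr factS [X in INR X <= _]/= !mult_INR.
have t_le : INR (balls st + s * n) <= INR (balls st + s) * INR n.+1.
  by rewrite -mult_INR; apply/le_INR/leP; nia.
have := Rmult_le_compat _ _ _ _ (pos_INR _) (pos_INR _) IHn t_le.
rewrite -[_ ^ n.+1]/(INR (balls st + s) * INR (balls st + s) ^ n).
by move=> /Rle_trans; apply; apply: Req_le; ring.
Qed.

End HistorySum.

(** * Law of the sequence of draws *)

Section DiscreteExpectation.
Local Open Scope classical_set_scope.
Local Open Scope ring_scope.
Variables (d : measure_display) (Omega : measurableType d) (rT : realType).
Variables (P : probability Omega rT) (T : countType) (X : Omega -> T).
Hypothesis mX : forall x, measurable [set omega | X omega = x].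

(** A preimage is a countable union of events X = x, enumerated by the pickling of T. *)
Lemma measurable_fun_discrete (G : T -> rT) : measurable_fun setT (fun omega => G (X omega)).
Proof.
move=> _ Y mY; rewrite setTI.
pose F k : set Omega := if unpickle k is Some x then
  [set omega | X omega = x /\ Y (G x)] else set0.
rewrite (_ : _ @^-1` _ = \bigcup_k F k).
  apply: bigcupT_measurable => k; rewrite /F; case: unpickle => // x.
  have [YG|nYG] := pselect (Y (G x)).
    by rewrite (_ : [set _ | _] = [set omega | X omega = x]) //;
      apply/seteqP; split=> omega /= => [[]|].
  by rewrite (_ : [set _ | _] = set0) //; apply/seteqP; split=> omega /= => [[]|].
apply/seteqP; split=> omega /= => [YG|[k _]].
  by exists (pickle (X omega)) => //; rewrite /F pickleK.
by rewrite /F; case: unpickle => // x [<-].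
Qed.

Variables (l : seq T) (p : T -> rT).
Hypotheses (l_uniq : uniq l)
  (Pp : forall x, x \in l -> P [set omega | X omega = x] = (p x)%:E).

Let E := \big[setU/set0]_(x <- l) [set omega | X omega = x].

Let mE : measurable E. Proof. exact: bigsetU_measurable. Qed.

Let integral_E (G : T -> rT) :
  (\int[P]_(omega in E) (G (X omega))%:E = (\sum_(x <- l) G x * p x)%:E)%E.
Proof.
rewrite integral_bigsetU_EFin //; first last.
- by apply/measurable_EFinP; apply: measurable_funS (measurable_fun_discrete G).
- by apply/trivIsetP => x y _ _ xy; apply/seteqP; split=> // omega [/= -> yE];
    rewrite yE eqxx in xy.
rewrite -sumEFin; apply: eq_big_seq => x x_in.
rewrite (eq_integral (cst (G x)%:E)); last by move=> omega; rewrite inE => /= ->.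
rewrite integral_cst; last exact: mX.
by rewrite EFinM -(Pp x_in).
Qed.

(** A list that carries the total mass 1 has a null complement, where G may be anything. *)
Lemma expectation_discrete (G : T -> rT) : \sum_(x <- l) p x = 1 ->
  expectation P (fun omega => G (X omega)) = (\sum_(x <- l) G x * p x)%:E.
Proof.
move=> p1; have PE : (P E = 1)%E.
  have := integral_E (cst 1); rewrite (eq_bigr p) => [|x _]; last by rewrite GRing.mul1r.
  by rewrite p1 (eq_integral (cst 1%:E)) // integral_cst // mul1e.
have PEc : P (~` E) = 0%E by rewrite probability_setC // PE subee.
rewrite unlock -[in LHS](setUv E) integral_setU //; first last.
- by apply/disj_setPCl.
- by rewrite setUv; apply/measurable_EFinP; apply: measurable_fun_discrete.
- exact: measurableC.
rewrite integral_E null_set_integral ?adde0 //; first exact: measurableC.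
by apply/measurable_EFinP; apply: measurable_funS (measurable_fun_discrete G).
Qed.

End DiscreteExpectation.

Section Probability.
Variables (d : measure_display) (Omega : measurableType d) (P : probability Omega R).
Variables (D : nat -> {RV P >-> nat}).
Local Open Scope classical_set_scope.

Lemma measurable_draws (n : nat) (w : seq nat) :
  measurable [set omega | draws D n omega = w].
Proof.
elim: n w => [|n IHn] w.
  have [->|w_neq0] := eqVneq w [::].
    by rewrite (_ : [set _ | _] = setT) //; apply/seteqP; split.
  rewrite (_ : [set _ | _] = set0) //; apply/seteqP; split=> // omega /= w0.
  by rewrite -w0 in w_neq0.
case/lastP: w => [|w i].
  by rewrite (_ : [set _ | _] = set0) //; apply/seteqP; split.
rewrite (_ : [set _ | _] = [set omega | draws D n omega = w] `&` (D n @^-1` [set i])).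
  apply: measurableI; first exact: IHn.
  exact: measurable_funPTI.
apply/seteqP; split=> omega /=; rewrite /draws mkseqS.
  by move=> /rcons_inj [].
by move=> [-> ->].
Qed.

Variables (a b s : nat) (st : nat * nat).
Hypotheses (ten : tenable a b s st.1 st.2) (unifD : uniform_draws a b s st D)
  (balls_gt0 : (0 < balls st)%nat).

(** The conditional probabilities along a history depend only on the total number of balls,
    which is the same for all histories of a given length. *)
Lemma prob_draws (n : nat) (w : seq nat) : w \in histories a b s st n ->
  P [set omega | draws D n omega = w] =
  (Rinv (INR (\prod_(j < n) (balls st + s * j))%nat))%:E%E.
Proof.
move=> w_in; rewrite -[LHS]fineK; last by apply: fin_num_measure; apply: measurable_draws.
congr EFin; elim: n w w_in => [|n IHn] w.
  rewrite inE => /eqP ->; rewrite big_ord0 Rinv_1.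
  rewrite (_ : [set _ | _] = setT); last by apply/seteqP; split.
  by rewrite probability_setT.
move=> /histories_rcons [v [i [-> v_in i_lt]]].
rewrite (unifD v_in i_lt) (IHn _ v_in) (tenable_histories ten v_in).
by rewrite big_ord_recr mult_INR Rinv_mult.
Qed.

Local Open Scope ring_scope.

(** Reassembles the real and imaginary parts, over which the expectation is computed
    separately, into a complex sum. *)
Lemma sum_list_scaled (T : Type) (l : seq T) (F : T -> C) (c : R) :
  (\sum_(w <- l) Re (F w) * c, \sum_(w <- l) Im (F w) * c) =
  Cmult (RtoC c) (\big[Cplus/RtoC 0%R]_(w <- l) F w).
Proof.
elim: l => [|w l IHl]; first by rewrite !big_nil Cmult_0_r.
rewrite !big_cons Cmult_plus_distr_l -IHl.
have re (x y S : R) : (x * c + S = c * x - 0 * y + S)%R by ring.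
have im (x y S : R) : (y * c + S = c * y + 0 * x + S)%R by ring.
by congr pair; [exact: re | exact: im].
Qed.

Lemma pgfE (n : nat) (u : C) :
  pgf a b s st D n u =
  Cmult (RtoC (Rinv (INR (\prod_(j < n) (balls st + s * j))%nat))) (history_sum a b s st n u).
Proof.
set p := Rinv _.
have p1 : (\sum_(w <- histories a b s st n) p = 1).
  rewrite big_const_seq count_predT GRing.iter_addr_0 size_histories //.
  rewrite /p; set N := (\prod_(j < n) _)%nat.
  have N_gt0 : (0 < N)%nat by apply: prodn_gt0 => j; rewrite ltn_addr.
  have N_neq0 : INR N <> 0%R by apply: not_0_INR; case: (N) N_gt0.
  have mulrnE (x : R) m : x *+ m = Rmult (INR m) x.
    elim: m => [|m IHm]; first by rewrite GRing.mulr0n Rmult_0_l.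
    by rewrite GRing.mulrS IHm S_INR Rmult_plus_distr_r Rmult_1_l; exact: Rplus_comm.
  by rewrite mulrnE Rinv_r.
have p_in w : w \in histories a b s st n -> P [set omega | draws D n omega = w] = p%:E.
  exact: prob_draws.
have mD := measurable_draws n.
have E := expectation_discrete mD (histories_uniq a b s n st) (p := fun=> p) p_in.
rewrite -sum_list_scaled /pgf /nb_black.
rewrite (E (fun w => Re (Cpow u (urn_state a b s st w).1)) p1).
by rewrite (E (fun w => Im (Cpow u (urn_state a b s st w).1)) p1).
Qed.
End Probability.

(** * Euler's Gamma function *)

Section GammaFunction.
Local Open Scope R_scope.

Lemma exp_le_mono x y : x <= y -> exp x <= exp y.
Proof. by move=> [/exp_increasing/Rlt_le | ->]; last exact: Rle_refl. Qed.

(** The three improper integrals below (existence of Gamma, integration by parts, Gamma 1)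
    all come from the limits of a primitive at 0 and at infinity. *)
Lemma is_RInt_gen_primitive (F f : R -> R) (l0 l1 : R) :
  (forall x, 0 < x -> is_derive F x (f x)) ->
  (forall x, 0 < x -> continuous f x) ->
  filterlim F (at_right 0) (locally l0) ->
  filterlim F (Rbar_locally p_infty) (locally l1) ->
  is_RInt_gen f (at_right 0) (Rbar_locally p_infty) (l1 - l0).
Proof.
move=> dF cf lim0 lim1.
apply: (filterlimi_lim_ext_loc (fun ab => F ab.2 - F ab.1)).
  apply: (Filter_prod _ _ _ (fun x => 0 < x) (fun x => 0 < x)).
  - by exists (mkposreal 1 Rlt_0_1).
  - by exists 0.
  - move=> x y x_gt0 y_gt0 /=.
    have xy_gt0 t : Rmin x y <= t <= Rmax x y -> 0 < t.
      by move=> [+ _]; apply: Rlt_le_trans; apply: Rmin_glb_lt.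
    by apply: (@is_RInt_derive R_CompleteNormedModule F f x y)
      => t /xy_gt0; [exact: dF | exact: cf].
apply: (filterlim_comp_2 (G := locally l1) (H := locally (opp l0))
          (fun ab => F ab.2) (fun ab => opp (F ab.1)) plus).
- by apply: filterlim_comp lim1; apply: filterlim_snd.
- apply: (filterlim_comp _ _ _ (fun ab => F ab.1) opp).
    by apply: filterlim_comp lim0; apply: filterlim_fst.
  exact: filterlim_opp.
- exact: filterlim_plus.
Qed.

Lemma bounded_incr_lim (F : R -> R) (M : R) :
  (forall x y, 1 <= x -> x <= y -> F x <= F y) ->
  (forall x, 1 <= x -> F x <= M) ->
  exists l : R, filterlim F (Rbar_locally p_infty) (locally l) /\
    forall x, 1 <= x -> F x <= l.
Proof.
move=> incrF leM.
pose E y := exists2 x, 1 <= x & y = F x.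
have [] := completeness E.
- by exists M => _ [x x1 ->]; apply: leM.
- by exists (F 1), 1; first apply: Rle_refl.
move=> l [ubl lubl]; exists l; split; last by move=> x x1; apply: ubl; exists x.
apply/filterlim_locally => eps.
have [x x1 Fx] : exists2 x, 1 <= x & l - eps < F x.
  apply: contrapT => nex; have : l <= l - eps.
    apply: lubl => _ [x x1 ->]; apply: Rnot_lt_le => lt; apply: nex.
    by exists x.
  by have := cond_pos eps; lra.
exists x => y xy; rewrite /ball /= /AbsRing_ball /= /abs /minus /plus /opp /=.
have Fy : F y <= l by apply: ubl; exists y => //; lra.
have Fxy : F x <= F y by apply: incrF; lra.
by apply: Rabs_def1; have := cond_pos eps; lra.
Qed.

Definition gamma_kernel (x t : R) : R := Rpower t (x - 1) * exp (- t).

Lemma gamma_kernel_gt0 x t : 0 < gamma_kernel x t.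
Proof. by apply: Rmult_lt_0_compat; apply: exp_pos. Qed.

Lemma is_derive_Rpower p t : 0 < t ->
  is_derive (fun y => Rpower y p) t (p * Rpower t (p - 1)).
Proof. by move=> t_gt0; apply/is_derive_Reals/derivable_pt_lim_power. Qed.

Lemma gamma_kernel_continuous x t : 0 < t -> continuous (gamma_kernel x) t.
Proof.
move=> t_gt0; apply: (ex_derive_continuous (gamma_kernel x)).
apply: ex_derive_mult; last by auto_derive.
by eexists; apply: is_derive_Rpower.
Qed.

Lemma ex_RInt_gamma_kernel x u v : 0 < u -> 0 < v ->
  ex_RInt (gamma_kernel x) u v.
Proof.
move=> u_gt0 v_gt0; apply: ex_RInt_continuous => t [+ _] => ut.
by apply: gamma_kernel_continuous; apply: Rlt_le_trans ut; apply: Rmin_glb_lt.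
Qed.

(** Exponential decay beats any power: a multiple of x ln t is absorbed by half of the
    exponent because ln lies below its tangent line at 2 x. *)
Lemma Rpower_exp_decay x t : 0 < x -> 1 <= t ->
  Rpower t x * exp (- t) <= exp (x * ln (2 * x)) * exp (- (t / 2)).
Proof.
move=> x_gt0 t_ge1; rewrite /Rpower -!exp_plus; apply: exp_le_mono.
have -> : ln t = ln (2 * x) + ln (t / (2 * x)).
  by rewrite -ln_mult; [congr ln; field; lra | lra |
    apply: Rdiv_lt_0_compat; lra].
have q_gt0 : 0 < t / (2 * x) by apply: Rdiv_lt_0_compat; lra.
have := exp_ineq1_le (ln (t / (2 * x))); rewrite exp_ln // => tangent.
have : x * ln (t / (2 * x)) <= x * (t / (2 * x) - 1) by apply: Rmult_le_compat_l; lra.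
have -> : x * (t / (2 * x) - 1) = t / 2 - x by field; lra.
by lra.
Qed.

Lemma is_derive_gamma_primitive x y : 0 < y ->
  is_derive (fun z => RInt (gamma_kernel x) 1 z) y (gamma_kernel x y).
Proof.
move=> y_gt0; apply: (is_derive_RInt _ _ 1); last exact: gamma_kernel_continuous.
exists (mkposreal y y_gt0) => z; rewrite /ball /= /AbsRing_ball /= /abs /minus /plus /opp /=.
move=> /Rabs_def2 [_ zy]; apply: RInt_correct.
by apply: ex_RInt_gamma_kernel; lra.
Qed.

Lemma gamma_kernel_increment x u v : 0 < u -> u <= v ->
  RInt (gamma_kernel x) 1 v - RInt (gamma_kernel x) 1 u = RInt (gamma_kernel x) u v.
Proof.
move=> u_gt0 uv; have v_gt0 : 0 < v by lra.
rewrite -(RInt_Chasles (gamma_kernel x) 1 u v); try apply: ex_RInt_gamma_kernel; try lra.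
by rewrite /plus /=; lra.
Qed.

Lemma gamma_primitive_incr x u v : 0 < u -> u <= v ->
  RInt (gamma_kernel x) 1 u <= RInt (gamma_kernel x) 1 v.
Proof.
move=> u_gt0 uv; suff : 0 <= RInt (gamma_kernel x) u v.
  by rewrite -gamma_kernel_increment //; lra.
apply: RInt_ge_0 => //; first by apply: ex_RInt_gamma_kernel; lra.
by move=> t _; apply/Rlt_le/gamma_kernel_gt0.
Qed.

(** Both ends of the integral are limits of the primitive based at 1, which increases:
    near infinity it is bounded by a decaying exponential, near 0 by the primitive
    t^x / x of t^(x-1). *)
Lemma is_Gamma x : 0 < x -> exists2 l : R,
  is_RInt_gen (gamma_kernel x) (at_right 0) (Rbar_locally p_infty) l & 0 < l.
Proof.
move=> x_gt0; pose F y := RInt (gamma_kernel x) 1 y.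
have F1 : F 1 = 0 by apply: RInt_point.
have [l1 [lim1 Fl1]] : exists l : R, filterlim F (Rbar_locally p_infty) (locally l) /\
    forall y, 1 <= y -> F y <= l.
  pose K := exp (x * ln (2 * x)).
  apply: (@bounded_incr_lim _ (2 * K)) => [u v u1 uv|y y1].
    by apply: gamma_primitive_incr => //; lra.
  pose G t := - (2 * K) * exp (- (t / 2)).
  have IG : is_RInt (fun t => K * exp (- (t / 2))) 1 y (minus (G y) (G 1)).
    apply: (@is_RInt_derive R_CompleteNormedModule) => t _.
      by rewrite /G; auto_derive => //; rewrite /Rdiv; field.
    by apply: (@ex_derive_continuous R_AbsRing R_NormedModule); auto_derive.
  have : F y <= minus (G y) (G 1).
    apply: is_RInt_le IG _ => //.
      by apply: RInt_correct; apply: ex_RInt_gamma_kernel; lra.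
    move=> t [t1 _]; apply: Rle_trans (Rpower_exp_decay x_gt0 (Rlt_le _ _ t1)).
    apply: Rmult_le_compat_r; first exact/Rlt_le/exp_pos.
    by apply: Rle_Rpower; lra.
  rewrite /minus /plus /opp /G /=.
  have K_gt0 : 0 < K by apply: exp_pos.
  have e1 : exp (- (1 / 2)) <= 1 by rewrite -[X in _ <= X]exp_0; apply: exp_le_mono; lra.
  have := exp_pos (- (y / 2)) => ey.
  have : K * exp (- (1 / 2)) <= K * 1 by apply: Rmult_le_compat_l; lra.
  have : 0 < K * exp (- (y / 2)) by apply: Rmult_lt_0_compat.
  by lra.
have [l0 [lim0 Fl0]] : exists l : R,
    filterlim (fun y => - F (/ y)) (Rbar_locally p_infty) (locally l) /\
    forall y, 1 <= y -> - F (/ y) <= l.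
  apply: (@bounded_incr_lim _ (/ x)) => [u v u1 uv|y y1].
    apply: Ropp_le_contravar; apply: gamma_primitive_incr.
      by apply: Rinv_0_lt_compat; lra.
    by apply: Rinv_le_contravar; lra.
  have iy_gt0 : 0 < / y by apply: Rinv_0_lt_compat; lra.
  have iy_le1 : / y <= 1 by rewrite -Rinv_1; apply: Rinv_le_contravar; lra.
  have t_gt0 t : Rmin (/ y) 1 <= t <= Rmax (/ y) 1 -> 0 < t.
    by rewrite Rmin_left //; lra.
  have IG : is_RInt (fun t => Rpower t (x - 1)) (/ y) 1
      (minus (/ x * Rpower 1 x) (/ x * Rpower (/ y) x)).
    apply: (@is_RInt_derive R_CompleteNormedModule (fun t => / x * Rpower t x))
      => t /t_gt0 t0.
      have := is_derive_scal _ t (/ x) _ (is_derive_Rpower x t0).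
      by congr is_derive; rewrite /scal /= /mult /=; field; lra.
    apply: (@ex_derive_continuous R_AbsRing R_NormedModule).
    by eexists; apply: is_derive_Rpower.
  have : RInt (gamma_kernel x) (/ y) 1 <= minus (/ x * Rpower 1 x) (/ x * Rpower (/ y) x).
    apply: is_RInt_le IG _ => //.
      by apply: RInt_correct; apply: ex_RInt_gamma_kernel; lra.
    move=> t [t1 _]; rewrite -[X in _ <= X]Rmult_1_r.
    apply: Rmult_le_compat_l; first exact/Rlt_le/exp_pos.
    by rewrite -[X in _ <= X]exp_0; apply: exp_le_mono; lra.
  rewrite -gamma_kernel_increment // -/(F 1) -/(F _) F1 /minus /plus /opp /=.
  have -> : Rpower 1 x = 1 by rewrite /Rpower ln_1 Rmult_0_r exp_0.
  have : 0 < / x * Rpower (/ y) x.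
    by apply: Rmult_lt_0_compat; [apply: Rinv_0_lt_compat | apply: exp_pos].
  by lra.
exists (l1 - - l0).
  apply: (is_RInt_gen_primitive (F := F)) lim1.
  - exact: is_derive_gamma_primitive.
  - exact: gamma_kernel_continuous.
  - apply: (filterlim_ext_loc (fun y => - - F (/ / y))).
      exists (mkposreal 1 Rlt_0_1) => y _ y_gt0.
      by rewrite Ropp_involutive Rinv_inv.
    apply: (filterlim_comp _ _ _ Rinv (fun y => - - F (/ y)) _ (Rbar_locally p_infty)).
      exact: filterlim_Rinv_0_right.
    apply: (filterlim_comp _ _ _ _ Ropp _ (locally l0)) => //.
    exact: (@filterlim_opp R_AbsRing R_NormedModule).
have := Fl0 1 (Rle_refl 1); rewrite Rinv_1 F1 => l0_ge0.
suff : 0 < F 2 by have := Fl1 2; lra.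
apply: RInt_gt_0; first lra.
  by move=> t _; apply: gamma_kernel_gt0.
by move=> t t1; apply: gamma_kernel_continuous; lra.
Qed.

Lemma GammaP x : 0 < x ->
  is_RInt_gen (gamma_kernel x) (at_right 0) (Rbar_locally p_infty) (Gamma x).
Proof.
move=> /is_Gamma [l Il _].
by rewrite /Gamma (is_RInt_gen_unique (gamma_kernel x) _ Il).
Qed.

Lemma Gamma_gt0 x : 0 < x -> 0 < Gamma x.
Proof.
move=> /is_Gamma [l Il l_gt0].
by rewrite /Gamma (is_RInt_gen_unique (gamma_kernel x) _ Il).
Qed.

Lemma lim_exp_half_p : filterlim (fun t => exp (- (t / 2))) (Rbar_locally p_infty) (locally 0).
Proof.
apply: (filterlim_comp _ _ _ (fun t => - (t / 2)) exp _ (Rbar_locally m_infty)).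
  move=> Q [M QM]; exists (- 2 * M) => t tM; apply: QM; lra.
exact: is_lim_exp_m.
Qed.

(** Integration by parts; the boundary terms are the limits of t^x exp(-t). *)
Lemma GammaS x : 0 < x -> Gamma (x + 1) = x * Gamma x.
Proof.
move=> x_gt0.
have Ix := GammaP x_gt0.
have x1_gt0 : 0 < x + 1 by lra.
have Ix1 := GammaP x1_gt0.
pose F t := Rpower t x * exp (- t).
pose f t := minus (scal x (gamma_kernel x t)) (gamma_kernel (x + 1) t).
have If : is_RInt_gen f (at_right 0) (Rbar_locally p_infty) (0 - 0).
  apply: (is_RInt_gen_primitive (F := F)).
  - move=> t t_gt0.
    have d2 : is_derive (fun y => exp (- y)) t (- exp (- t)) by auto_derive => //; ring.
    have := is_derive_mult _ _ t _ _ (is_derive_Rpower x t_gt0) d2 Rmult_comm.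
    congr is_derive; rewrite /f /gamma_kernel /minus /plus /opp /mult /scal /= /mult /=.
    by rewrite (_ : x + 1 - 1 = x); [ring | ring].
  - move=> t t_gt0; apply: continuous_minus; last exact: gamma_kernel_continuous.
    apply: (continuous_scal_r x); exact: gamma_kernel_continuous.
  - have lim_pow : filterlim (fun t => Rpower t x) (at_right 0) (locally 0).
      apply: (filterlim_comp _ _ _ (fun t => x * ln t) exp _ (Rbar_locally m_infty));
        last exact: is_lim_exp_m.
      apply: (filterlim_comp _ _ _ ln (fun t => x * t) _ (Rbar_locally m_infty)).
        exact: is_lim_ln_0.
      move=> Q [M QM]; exists (M / x) => t tM; apply: QM.
      by have := Rmult_lt_compat_l x _ _ x_gt0 tM; rewrite (_ : x * (M / x) = M) //; field; lra.
    rewrite -[X in locally X](Rmult_0_l (exp (- 0))).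
    apply: (filterlim_comp_2 (G := locally 0) (H := locally (exp (- 0)))
      (fun t => Rpower t x) (fun t => exp (- t)) Rmult) => //.
      apply: (@filterlim_filter_le_1 _ _ (locally 0)); first exact: filter_le_within.
      apply: (@ex_derive_continuous R_AbsRing R_NormedModule (fun t => exp (- t)) 0).
      by auto_derive.
    exact: (@filterlim_mult R_AbsRing).
  - pose K := exp (x * ln (2 * x)).
    apply: (filterlim_le_le (fun _ => 0) F (fun t => K * exp (- (t / 2))) 0).
    + exists 1 => t t1; split.
        by apply/Rlt_le/Rmult_lt_0_compat; apply: exp_pos.
      by apply: Rpower_exp_decay; lra.
    + exact: filterlim_const.
    + rewrite -(Rmult_0_r K).
      apply: (filterlim_comp _ _ _ _ (Rmult K) _ (locally 0)).
        exact: lim_exp_half_p.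
      exact: (@filterlim_scal_r R_AbsRing R_NormedModule K 0).
have If' : is_RInt_gen f (at_right 0) (Rbar_locally p_infty)
    (minus (scal x (Gamma x)) (Gamma (x + 1))).
  by refine (is_RInt_gen_minus _ _ _ _ _ Ix1); refine (is_RInt_gen_scal _ x _ Ix).
have uniq_If l : is_RInt_gen f (at_right 0) (Rbar_locally p_infty) l ->
  RInt_gen f (at_right 0) (Rbar_locally p_infty) = l.
  by move=> Il; refine (is_RInt_gen_unique f l Il).
have := uniq_If _ If'; rewrite (uniq_If _ If) /minus /plus /opp /scal /= /mult /=.
by lra.
Qed.

Lemma Gamma1 : Gamma 1 = 1.
Proof.
rewrite /Gamma; refine (is_RInt_gen_unique _ _ _).
rewrite -[X in is_RInt_gen _ _ _ X](_ : 0 - - 1 = 1); last ring.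
apply: (is_RInt_gen_primitive (F := fun t => - exp (- t))).
- move=> t _; auto_derive => //; rewrite /Rpower Rminus_diag Rmult_0_l exp_0; ring.
- by move=> t t_gt0; apply: (@gamma_kernel_continuous 1 t).
- rewrite -[X in locally (- X)]exp_0 -[X in locally (- exp X)]Ropp_0.
  apply: (@filterlim_filter_le_1 _ _ (locally 0)); first exact: filter_le_within.
  by apply: (@ex_derive_continuous R_AbsRing R_NormedModule (fun t => - exp (- t)) 0); auto_derive.
- rewrite -[X in locally X]Ropp_0; apply: (filterlim_comp _ _ _ (fun t => exp (- t)) Ropp _ (locally 0));
    last exact: (@filterlim_opp R_AbsRing R_NormedModule).
  apply: (filterlim_comp _ _ _ Ropp exp _ (Rbar_locally m_infty)); last exact: is_lim_exp_m.
  by move=> Q [M QM]; exists (- M) => t tM; apply: QM; lra.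
Qed.

Lemma Gamma_fact n : Gamma (INR n + 1) = INR n`!.
Proof.
elim: n => [|n IHn]; first by rewrite /= Rplus_0_l Gamma1.
rewrite S_INR GammaS; last by have := pos_INR n; lra.
by rewrite IHn factS mult_INR S_INR.
Qed.

(** Each factor t + s j is s times the argument j + t / s of the functional equation. *)
Lemma Gamma_rising (t s n : nat) : (0 < t)%nat -> (0 < s)%nat ->
  INR s ^ n * Gamma (INR n + INR t / INR s) =
  INR (\prod_(j < n) (t + s * j))%nat * Gamma (INR t / INR s).
Proof.
move=> t_gt0 s_gt0.
have tR : 0 < INR t by apply/lt_0_INR/ltP.
have sR : 0 < INR s by apply/lt_0_INR/ltP.
have q_gt0 : 0 < INR t / INR s by apply: Rdiv_lt_0_compat.
elim: n => [|n IHn]; first by rewrite big_ord0 /= Rplus_0_l.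
have -> : INR (\prod_(j < n.+1) (t + s * j))%nat =
    INR (\prod_(j < n) (t + s * j))%nat * (INR t + INR s * INR n).
  by rewrite big_ord_recr mult_INR plus_INR mult_INR.
rewrite (_ : INR n.+1 + INR t / INR s = INR n + INR t / INR s + 1); last by rewrite S_INR; ring.
rewrite GammaS; last by have := pos_INR n; lra.
transitivity (INR s * (INR n + INR t / INR s) * (INR s ^ n * Gamma (INR n + INR t / INR s))).
  by rewrite -[_ ^ n.+1]/(INR s * INR s ^ n); ring.
by rewrite IHn; field; lra.
Qed.

Lemma Gamma_factor (t s n : nat) : (0 < t)%nat -> (0 < s)%nat ->
  Gamma (INR n + 1) * Gamma (INR t / INR s) / (INR s ^ n * Gamma (INR n + INR t / INR s)) =
  INR n`! / INR (\prod_(j < n) (t + s * j))%nat.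
Proof.
move=> t_gt0 s_gt0; rewrite Gamma_rising // Gamma_fact.
have q_gt0 : 0 < INR t / INR s.
  by apply: Rdiv_lt_0_compat; apply/lt_0_INR/ltP.
have := Gamma_gt0 q_gt0.
have prod_gt0 : 0 < INR (\prod_(j < n) (t + s * j))%nat.
  by apply/lt_0_INR/ltP/prodn_gt0 => j; rewrite ltn_addr.
by move=> ?; field; split; lra.
Qed.

End GammaFunction.

(** * Complex roots and derivatives along the real line *)

Section ComplexDerivative.
Local Open Scope R_scope.

(** Stated on components, so that real calculus (chain rule, mean value theorem) applies. *)
Definition is_Cderive (f : R -> C) (x : R) (l : C) : Prop :=
  is_derive (fun y => Re (f y)) x (Re l) /\ is_derive (fun y => Im (f y)) x (Im l).

Lemma is_derive_eq (f : R -> R) x l m : is_derive f x l -> l = m -> is_derive f x m.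
Proof. by move=> df <-. Qed.

Lemma is_Cderive_eq f x l m : is_Cderive f x l -> l = m -> is_Cderive f x m.
Proof. by move=> df <-. Qed.

Lemma is_Cderive_ext f g x l :
  (forall y, f y = g y) -> is_Cderive f x l -> is_Cderive g x l.
Proof. by move=> /funext ->. Qed.

Lemma is_Cderive_const c x : is_Cderive (fun=> c) x 0.
Proof. by split; apply: is_derive_const. Qed.

Lemma is_Cderive_plus f g x l m :
  is_Cderive f x l -> is_Cderive g x m ->
  is_Cderive (fun y => f y + g y)%C x (l + m)%C.
Proof. by move=> [? ?] [? ?]; split; apply: is_derive_plus. Qed.

Lemma is_Cderive_mult f g x l m :
  is_Cderive f x l -> is_Cderive g x m ->
  is_Cderive (fun y => f y * g y)%C x (l * g x + f x * m)%C.
Proof.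
move=> [fr fi] [gr gi]; split.
  apply: is_derive_eq (is_derive_minus _ _ x _ _
    (is_derive_mult _ _ x _ _ fr gr Rmult_comm) (is_derive_mult _ _ x _ _ fi gi Rmult_comm)) _.
  by rewrite /Re /Im /minus /plus /opp /mult /=; ring.
apply: is_derive_eq (is_derive_plus _ _ x _ _
  (is_derive_mult _ _ x _ _ fr gi Rmult_comm) (is_derive_mult _ _ x _ _ fi gr Rmult_comm)) _.
by rewrite /Re /Im /minus /plus /opp /mult /=; ring.
Qed.

Lemma is_Cderive_scal c f x l :
  is_Cderive f x l -> is_Cderive (fun y => c * f y)%C x (c * l)%C.
Proof.
by move=> df; have := is_Cderive_mult (is_Cderive_const c x) df; rewrite Cmult_0_l Cplus_0_l.
Qed.

Lemma is_Cderive_pow f x l n :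
  is_Cderive f x l ->
  is_Cderive (fun y => Cpow (f y) n) x (INR n * Cpow (f x) n.-1 * l)%C.
Proof.
move=> df; elim: n => [|n IHn].
  by rewrite /= !Cmult_0_l; apply: is_Cderive_const.
apply: is_Cderive_eq (is_Cderive_mult df IHn) _.
rewrite [in RHS]S_INR RtoC_plus; case: n {IHn} => [|n]; first by rewrite /=; ring.
by rewrite -!pred_Sn !Cpow_S; ring.
Qed.

(** Lets automatic differentiation see two abstract real functions instead of the components
    of a complex one. *)
Lemma Cfun_pair_ind (Q : (R -> C) -> Prop) :
  (forall p q : R -> R, Q (fun y => (p y, q y))) -> forall f, Q f.
Proof.
move=> Qpq f; have -> : f = fun y => (Re (f y), Im (f y)) by apply/funext => y; case: (f y).
exact: Qpq.
Qed.

Lemma is_Cderive_inv (f : R -> C) x l :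
  f x <> 0 -> is_Cderive f x l -> is_Cderive (fun y => / f y)%C x (- l / (f x * f x))%C.
Proof.
elim/Cfun_pair_ind: f => p q /= f_neq0 [/= dp dq].
have n2_gt0 : 0 < p x ^ 2 + q x ^ 2.
  apply: Rnot_le_lt => n2_le0; apply: f_neq0.
  have sq0 y : y ^ 2 <= 0 -> y = 0.
    by have := pow2_ge_0 y => ? ?; apply: Rsqr_eq_0; rewrite Rsqr_pow2; lra.
  rewrite /RtoC; congr pair; apply: sq0; have := pow2_ge_0 (p x); have := pow2_ge_0 (q x); lra.
have exp : ex_derive p x by eexists; exact: dp.
have exq : ex_derive q x by eexists; exact: dq.
have Dp := is_derive_unique _ _ _ dp; have Dq := is_derive_unique _ _ _ dq.
rewrite /= in n2_gt0.
have n4_gt0 : 0 < (p x * p x - q x * q x) ^ 2 + (p x * q x + q x * p x) ^ 2.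
  by rewrite (_ : _ + _ = (p x ^ 2 + q x ^ 2) ^ 2); [apply: pow_lt | ring].
case: l dp dq Dp Dq => l1 l2 /= dp dq Dp Dq; rewrite /= in n2_gt0 n4_gt0.
split; rewrite /Cdiv /Cinv /Cmult /Copp /=; auto_derive; rewrite /= ?Dp ?Dq.
- by do 5 (split=> //); split=> //; lra.
- by field; split; lra.
- by do 5 (split=> //); split=> //; lra.
- by field; split; lra.
Qed.

Lemma Cpolar_pow (r t : R) n :
  Cpow (RtoC r * (cos t, sin t))%C n = (RtoC (r ^ n) * (cos (INR n * t), sin (INR n * t)))%C.
Proof.
elim: n => [|n IHn]; first by rewrite /= Rmult_0_l cos_0 sin_0 Cmult_1_l.
rewrite Cpow_S IHn S_INR Rmult_plus_distr_r Rmult_1_l cos_plus sin_plus /=.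
by rewrite /Cmult /=; congr pair; ring.
Qed.

(** De Moivre's formula; the arctangent of Im w / Re w is the argument of w because w lies
    in the right half-plane. *)
Lemma Croot_pow h w : (0 < h)%nat -> 0 < Re w -> Cpow (Croot h w) h = w.
Proof.
move=> h_gt0 w_gt0; have h_neq0 : INR h <> 0 by apply: not_0_INR; lia.
have m_gt0 : 0 < Cmod w by apply: Rlt_le_trans (re_le_Cmod w); rewrite Rabs_pos_eq; lra.
rewrite /Croot Cpolar_pow -Rpower_pow; last exact: exp_pos.
rewrite Rpower_mult Rinv_l // Rpower_1 //.
rewrite (_ : INR h * _ = atan (Im w / Re w)); last by field.
rewrite cos_atan sin_atan.
have -> : sqrt (1 + (Im w / Re w)²) = Cmod w / Re w.
  apply: sqrt_lem_1; first by rewrite /Rsqr; nra.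
    by apply/Rlt_le/Rdiv_lt_0_compat.
  rewrite (_ : _ * _ = Cmod w ^ 2 / (Re w) ^ 2); last by field; lra.
  by rewrite Cmod2_alt /Rsqr; field; lra.
case: w w_gt0 m_gt0 => x y /= x_gt0 m_gt0; rewrite /Cmult /=.
by congr pair; field; lra.
Qed.

Lemma Croot_neq0 h w : Croot h w <> 0.
Proof.
move=> /(f_equal Cmod); rewrite Cmod_0 /Croot Cmod_mult Cmod_R.
rewrite Rabs_pos_eq; last exact/Rlt_le/exp_pos.
have -> t : Cmod (cos t, sin t) = 1.
  by rewrite /Cmod /= !Rmult_1_r Rplus_comm sin2_cos2 sqrt_1.
by have := exp_pos (/ INR h * ln (Cmod w)); rewrite /Rpower; lra.
Qed.

(** The modulus and the angle of the root are the exponential of 1/h times the real part,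
    and 1/h times the imaginary part, of the principal logarithm of f, whose derivative is
    f' / f. *)
Lemma is_Cderive_Croot h (f : R -> C) x l : (0 < h)%nat -> 0 < Re (f x) -> is_Cderive f x l ->
  is_Cderive (fun y => Croot h (f y)) x (Croot h (f x) * (RtoC (/ INR h) * (l / f x)))%C.
Proof.
move=> h_gt0; have h_neq0 : INR h <> 0 by apply: not_0_INR; lia.
elim/Cfun_pair_ind: f => p q /= f_gt0 [/= dp dq].
have n2_gt0 : 0 < p x ^ 2 + q x ^ 2 by nra.
have exp_p : ex_derive p x by eexists; exact: dp.
have exp_q : ex_derive q x by eexists; exact: dq.
have Dp := is_derive_unique _ _ _ dp; have Dq := is_derive_unique _ _ _ dq.
have sqrt_gt0 := sqrt_lt_R0 _ n2_gt0.
have sqrtE := sqrt_sqrt _ (Rlt_le _ _ n2_gt0).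
rewrite /Croot /Rpower /Cmod /Cdiv /Cinv /Cmult /=.
rewrite /= in n2_gt0 sqrt_gt0 sqrtE *.
have sqrt2E y : y * / (2 * sqrt (p x * (p x * 1) + q x * (q x * 1))) *
    / sqrt (p x * (p x * 1) + q x * (q x * 1)) =
    y * / (2 * (p x * (p x * 1) + q x * (q x * 1))).
  by rewrite -[in RHS]sqrtE; field; lra.
have ineq0 : p x * (p x * 1) + q x * (q x * 1) <> 0 by lra.
case: l dp dq Dp Dq => l1 l2 /= dp dq Dp Dq.
split=> /=; auto_derive; rewrite /= ?Dp ?Dq ?sqrt2E /Rdiv; try by repeat split=> //; lra.
  move: (cos _) (sin _) (exp _) => c t e.
  by field; repeat split=> //; lra.
move: (cos _) (sin _) (exp _) => c t e.
by field; repeat split=> //; lra.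
Qed.

(** The mean value theorem holds for each component only, which costs a factor: 2 bounds
    the square root of 2 from comparing the modulus with the larger component. *)
Lemma Cmod_increment_le (g g' : R -> C) M :
  (forall x, 0 <= x <= 1 -> is_Cderive g x (g' x)) ->
  (forall x, 0 <= x <= 1 -> Cmod (g' x) <= M) ->
  Cmod (g 1 - g 0)%C <= 2 * M.
Proof.
move=> dg g'_le.
have mvt (f f' : R -> R) : (forall x, 0 <= x <= 1 -> is_derive f x (f' x)) ->
    (forall x, 0 <= x <= 1 -> Rabs (f' x) <= M) -> Rabs (f 1 - f 0) <= M.
  move=> df f'_le; have [] := MVT_gen f 0 1 f'.
  - by move=> x; rewrite Rmin_left ?Rmax_right; try lra; move=> x_in; apply: df; lra.
  - move=> x; rewrite Rmin_left ?Rmax_right; try lra; move=> x_in.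
    apply/continuity_pt_filterlim.
    by apply: (@ex_derive_continuous R_AbsRing R_NormedModule); eexists; apply: df.
  - move=> x; rewrite Rmin_left ?Rmax_right; try lra.
    by move=> [x_in ->]; rewrite Rminus_0_r Rmult_1_r; apply: f'_le.
have re_le : Rabs (g 1 - g 0)%C.1 <= M.
  apply: (mvt (fun x => Re (g x)) (fun x => Re (g' x))) => x x_in; first by case: (dg x x_in).
  exact: Rle_trans (re_le_Cmod _) (g'_le x x_in).
have im_le : Rabs (g 1 - g 0)%C.2 <= M.
  apply: (mvt (fun x => Im (g x)) (fun x => Im (g' x))) => x x_in; first by case: (dg x x_in).
  apply: Rle_trans (g'_le x x_in); apply: Rle_trans (Rmax_Cmod _); exact: Rmax_r.
have M_ge0 : 0 <= M by apply: Rle_trans (Rabs_pos _) re_le.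
apply: Rle_trans (Cmod_2Rmax _) _; apply: Rmult_le_compat.
- exact: sqrt_pos.
- by apply: Rle_trans (Rmax_l _ _); apply: Rabs_pos.
- by apply: Rsqr_incr_0_var; [rewrite Rsqr_sqrt /Rsqr; lra | lra].
- exact: Rmax_lub.
Qed.

Lemma Cmod_scale_le (x r : R) (u : C) : 0 <= x <= 1 -> Cmod u <= r -> Cmod (x * u) <= r.
Proof.
move=> x_in u_le; rewrite Cmod_mult Cmod_R Rabs_pos_eq; last lra.
by have := Cmod_ge_0 u; nra.
Qed.

End ComplexDerivative.

(** * Complex power series *)

Section ComplexSeries.
Local Open Scope R_scope.

Lemma Csum_ext (f g : nat -> C) N : (forall n, f n = g n) ->
  sum_n (G := C_AbelianGroup) f N = sum_n (G := C_AbelianGroup) g N.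
Proof. by move=> /funext ->. Qed.

(** Turns convergence in C into a limit of real numbers, to be reached by squeezing. *)
Lemma is_series_Cmod (c : nat -> C) (l : C) :
  is_series (V := C_NormedModule) c l <->
  is_lim_seq (fun N => Cmod (sum_n (G := C_AbelianGroup) c N - l)%C) 0.
Proof.
split=> lim.
  apply/is_lim_seq_spec => eps.
  have /filterlim_locally_ball_norm /(_ eps) [N HN] := lim.
  exists N => n /HN; rewrite /ball_norm Rminus_0_r (Rabs_pos_eq _ (Cmod_ge_0 _)).
  by [].
apply/filterlim_locally_ball_norm => eps.
have /is_lim_seq_spec /(_ eps) [N HN] := lim.
exists N => n /HN; rewrite /ball_norm Rminus_0_r (Rabs_pos_eq _ (Cmod_ge_0 _)).
by [].
Qed.

Lemma pow_nE (w : C) n : pow_n (K := C_AbsRing) w n = Cpow w n.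
Proof. by elim: n => [//|n IHn]; rewrite Cpow_S -IHn. Qed.

Lemma pseries_termE (c : nat -> C) (w : C) :
  (fun k => scal (V := C_NormedModule) (pow_n (K := C_AbsRing) w k) (c k)) =
  (fun k => Cpow w k * c k)%C.
Proof. by apply/funext => k; rewrite pow_nE. Qed.

Lemma is_pseries_Cmod (c : nat -> C) (w l : C) :
  @is_pseries C_AbsRing C_NormedModule c w l <->
  is_lim_seq (fun N =>
    Cmod (sum_n (G := C_AbelianGroup) (fun k => Cpow w k * c k)%C N - l)%C) 0.
Proof.
by rewrite /is_pseries is_series_Cmod pseries_termE.
Qed.

Lemma is_pseries_C_unique (c : nat -> C) (w l m : C) :
  @is_pseries C_AbsRing C_NormedModule c w l ->
  @is_pseries C_AbsRing C_NormedModule c w m -> l = m.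
Proof. by move=> cl cm; refine (filterlim_locally_unique _ _ _ cl cm). Qed.

(** At a zero w close to 0 the first nonzero term d_n w^n would have to be cancelled by the
    later ones, but these are bounded by a geometric series of ratio q = |w| / rho, hence
    smaller by a factor of order q. *)
Lemma pseries_zero_coef (d : nat -> C) (rho M : R) :
  0 < rho -> (forall k, Cmod (d k) * rho ^ k <= M) ->
  (forall eta, 0 < eta -> exists w : C, [/\ w <> 0, Cmod w < eta &
     @is_pseries C_AbsRing C_NormedModule d w (RtoC 0)]) ->
  forall n, d n = 0.
Proof.
move=> rho_gt0 d_le zeros n.
have M_ge0 : 0 <= M by have := d_le 0%nat; have := Cmod_ge_0 (d 0%nat); rewrite /=; lra.
elim/ltn_ind: n => n IHn; apply: contrapT => dn_neq0.
have dn_gt0 : 0 < Cmod (d n) by apply/Cmod_gt_0.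
have rn_gt0 : 0 < rho ^ n by apply: pow_lt.
pose A := Cmod (d n) * rho ^ n.
have A_gt0 : 0 < A by apply: Rmult_lt_0_compat.
(* The ratio q must be at most 1/2 to sum the tail by 2 M q^(n+1), and less than A / (2 M)
   to contradict A q^n <= 2 M q^(n+1); adding 1 keeps the denominator positive. *)
have eta_gt0 : 0 < Rmin (/ 2) (A / (2 * M + 1)) * rho.
  apply: Rmult_lt_0_compat => //; apply: Rmin_glb_lt; first lra.
  by apply: Rdiv_lt_0_compat; lra.
have [w [w_neq0 w_lt /is_pseries_Cmod w_zero]] := zeros _ eta_gt0.
pose q := Cmod w / rho.
have q_gt0 : 0 < q by apply: Rdiv_lt_0_compat => //; apply/Cmod_gt_0.
have wE : Cmod w = q * rho by rewrite /q; field; lra.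
have q_lt : q < Rmin (/ 2) (A / (2 * M + 1)).
  by apply: (Rmult_lt_reg_r rho) => //; rewrite -wE.
have q_lt2 : q < / 2 by apply: Rlt_le_trans q_lt (Rmin_l _ _).
have q_ltA : q * (2 * M + 1) < A.
  have lt := Rlt_le_trans _ _ _ q_lt (Rmin_r _ _).
  have M1_gt0 : 0 < 2 * M + 1 by lra.
  have := Rmult_lt_compat_r _ _ _ M1_gt0 lt.
  by rewrite (_ : A / _ * _ = A) //; field; lra.
pose S (N : nat) : C := sum_n (G := C_AbelianGroup) (fun k => Cpow w k * d k)%C N.
have term_le k : Cmod (Cpow w k * d k)%C <= M * q ^ k.
  rewrite Cmod_mult Cmod_pow wE Rpow_mult_distr.
  have := Rmult_le_compat_r _ _ _ (pow_le _ k (Rlt_le _ _ q_gt0)) (d_le k).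
  by lra.
have S_small k : (k < n)%nat -> S k = 0.
  elim: k => [|k IHk] k_lt; first by rewrite /S sum_O IHn // Cmult_0_r.
  by rewrite /S sum_Sn -/(S k) IHk 1?ltnW // IHn // Cmult_0_r plus_zero_l.
have Sn : S n = (Cpow w n * d n)%C.
  case: (n) S_small => [|k] S_small; first by rewrite /S sum_O.
  by rewrite /S sum_Sn -/(S k) S_small // plus_zero_l.
have tail m : Cmod (S (n + m)%nat - S n)%C <= 2 * M * q ^ n.+1 * (1 - (/ 2) ^ m).
  elim: m => [|m IHm].
    by rewrite addn0 (_ : (_ - _)%C = 0%C) ?Cmod_0 /=; [lra | ring].
  have SS : S (n + m).+1 = (S (n + m)%nat + Cpow w (n + m).+1 * d (n + m).+1)%C.
    by rewrite /S sum_Sn.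
  rewrite addnS SS.
  rewrite (_ : (_ - S n)%C = (S (n + m)%nat - S n + Cpow w (n + m).+1 * d (n + m).+1)%C); last by ring.
  apply: Rle_trans (Cmod_triangle _ _) _.
  apply: Rle_trans (Rplus_le_compat _ _ _ _ IHm (term_le _)) _.
  have -> : q ^ (n + m).+1 = q ^ n.+1 * q ^ m by rewrite -pow_add; congr pow; lia.
  have qm_le : q ^ m <= (/ 2) ^ m by apply: pow_incr; lra.
  have := Rmult_le_compat_l (M * q ^ n.+1) _ _ _ qm_le.
  have : 0 <= M * q ^ n.+1 by apply: Rmult_le_pos => //; apply: pow_le; lra.
  by rewrite -[(/ 2) ^ m.+1]/(/ 2 * (/ 2) ^ m); lra.
have Sn_le : Cmod (S n) <= 2 * M * q ^ n.+1.
  suff : Rbar_le (Cmod (S n)) (2 * M * q ^ n.+1 + 0) by rewrite /= Rplus_0_r.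
  apply: (is_lim_seq_le (fun=> Cmod (S n)) (fun m => 2 * M * q ^ n.+1 + Cmod (S (m + n)%nat - 0)%C)).
  - move=> m; have -> : S n = (- (S (m + n)%nat - S n) + (S (m + n)%nat - 0))%C by ring.
    apply: Rle_trans (Cmod_triangle _ _) _; apply: Rplus_le_compat_r.
    rewrite Cmod_opp addnC; apply: Rle_trans (tail m) _.
    have : 0 <= 2 * M * q ^ n.+1 by apply: Rmult_le_pos; [lra | apply: pow_le; lra].
    have : 0 < (/ 2) ^ m by apply: pow_lt; lra.
    by nra.
  - exact: is_lim_seq_const.
  - apply: is_lim_seq_plus'; first exact: is_lim_seq_const.
    exact: (is_lim_seq_incr_n (fun m => Cmod (S m - 0)%C) n 0).1.
move: Sn_le; rewrite Sn Cmod_mult Cmod_pow wE Rpow_mult_distr /= => Sn_le.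
have qn_gt0 : 0 < q ^ n by apply: pow_lt.
have : q ^ n * A <= q ^ n * (2 * M * q) by rewrite /A; lra.
by move=> /(Rmult_le_reg_l _ _ _ qn_gt0); lra.
Qed.

(** Each term is a difference of two partial sums, and a convergent sequence is bounded. *)
Lemma pseries_coef_bounded (c : nat -> C) (w l : C) :
  @is_pseries C_AbsRing C_NormedModule c w l ->
  exists M, forall k, Cmod (c k) * Cmod w ^ k <= M.
Proof.
rewrite /is_pseries pseries_termE => cv.
pose S (N : nat) : C := sum_n (G := C_AbelianGroup) (fun k => Cpow w k * c k)%C N.
have [M le_M] : exists M, forall N, Cmod (S N) <= M.
  have [M le_M] := @filterlim_bounded C_AbsRing C_NormedModule S (ex_intro _ l cv).
  by exists M.
exists (2 * M) => k; rewrite -Cmod_pow -Cmod_mult Cmult_comm.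
have M_ge0 : 0 <= M by apply: Rle_trans (Cmod_ge_0 _) (le_M 0%nat).
case: k => [|k]; first by have := le_M 0%nat; rewrite /S sum_O; lra.
have SS : S k.+1 = (S k + Cpow w k.+1 * c k.+1)%C by rewrite /S sum_Sn.
rewrite (_ : (_ * _)%C = (S k.+1 - S k)%C); last by rewrite SS; ring.
apply: Rle_trans (Cmod_triangle _ _) _; rewrite Cmod_opp.
by have := le_M k; have := le_M k.+1; lra.
Qed.

(** Identity theorem: the zeros of f1 - f2 accumulate at 0, the centre of the series. *)
Lemma pseries_eq_near0 (c1 c2 : nat -> C) (f1 f2 : C -> C) (r : R) : 0 < r ->
  (forall w, Cmod w < r -> @is_pseries C_AbsRing C_NormedModule c1 w (f1 w)) ->
  (forall w, Cmod w < r -> @is_pseries C_AbsRing C_NormedModule c2 w (f2 w)) ->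
  (forall eta, 0 < eta -> exists w : C, [/\ w <> 0, Cmod w < eta & f1 w = f2 w]) ->
  forall w, Cmod w < r -> f1 w = f2 w.
Proof.
move=> r_gt0 s1 s2 agree w w_lt.
have sd v : Cmod v < r -> f1 v = f2 v ->
    @is_pseries C_AbsRing C_NormedModule (PS_minus c1 c2) v (RtoC 0).
  move=> v_lt fE; have -> : RtoC 0 = minus (f1 v : C_NormedModule) (f2 v).
    by rewrite fE; symmetry; apply: (@plus_opp_r C_NormedModule).
  by apply: is_pseries_minus; [apply: s1 | apply: s2].
have r2_lt : Cmod (RtoC (r / 2)) < r by rewrite Cmod_R Rabs_pos_eq; lra.
have := is_pseries_minus _ _ _ _ _ (s1 _ r2_lt) (s2 _ r2_lt).
move=> /pseries_coef_bounded [M]; rewrite Cmod_R Rabs_pos_eq; last lra.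
have r2_gt0 : 0 < r / 2 by lra.
move=> /(pseries_zero_coef r2_gt0) zero_coef.
have c12 n : c1 n = c2 n.
  have : PS_minus c1 c2 n = RtoC 0.
    apply: zero_coef => eta eta_gt0.
    have min_gt0 : 0 < Rmin eta r by apply: Rmin_glb_lt.
    have [v [v_neq0 v_lt fE]] := agree _ min_gt0.
    exists v; split=> //; first exact: Rlt_le_trans v_lt (Rmin_l _ _).
    by apply: sd fE; apply: Rlt_le_trans v_lt (Rmin_r _ _).
  rewrite /PS_minus /PS_plus /PS_opp /plus /opp /= => d0.
  by rewrite -[c2 n]Cplus_0_l -d0; ring.
apply: is_pseries_C_unique (s1 w w_lt) _.
by rewrite (funext c12); apply: s2.
Qed.

End ComplexSeries.

(** * Flow of the urn along a segment *)

Section UrnFlow.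
Local Open Scope R_scope.

Lemma Cpow_pred_mul (X : C) k : (INR k * Cpow X k.-1 * X = INR k * Cpow X k)%C.
Proof. by case: k => [|k]; [rewrite /= !Cmult_0_l | rewrite -pred_Sn Cpow_S; ring]. Qed.

(** The case n = 0 of [flow_coef_derive], with X for x u and Dl for delta (x u).  Replacing
    Dl^h by 1 - X^h, both sides are u (k X^(k-1) + l X^(k+h-1)) / Dl^(k+l+h).  A nonzero k is
    at least a and a nonzero l at least b, so the subtractions in the exponents are exact
    wherever their coefficient is not 0. *)
Lemma flow_base_identity (a b s k l : nat) (u X Dl : C) :
  (0 < a)%nat -> tenable a b s k l -> Dl <> 0 ->
  Cpow Dl (a + b + s)%nat = (1 - Cpow X (a + b + s)%nat)%C ->
  (INR k * Cpow X k.-1 * u * / Cpow Dl (k + l)%nat + Cpow X k *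
   (- (INR (k + l)%nat * Cpow Dl (k + l).-1 *
      - (u * Cpow X (a + b + s).-1 * Dl / Cpow Dl (a + b + s)%nat)) /
    (Cpow Dl (k + l)%nat * Cpow Dl (k + l)%nat)))%C =
  (u * (Cpow X (a - 1)%nat / Cpow Dl (a + b)%nat) *
   (INR k * (Cpow X (k - a)%nat * / Cpow Dl (k - a + (l + (a + s)))%nat) +
    INR l * (Cpow X (k + (b + s))%nat * / Cpow Dl (k + (b + s) + (l - b))%nat)))%C.
Proof.
move=> a_gt0 /and4P[ak bl _ _] Dl_neq0 DlE; set h := (a + b + s)%nat in DlE *.
have neq0 m : Cpow Dl m <> 0 by apply/Cpow_nz.
have hS : h = h.-1.+1 by rewrite prednK // /h; lia.
have DhE : Cpow Dl h = (Cpow Dl (a + b)%nat * Cpow Dl s)%C by rewrite -Cpow_add_r.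
transitivity (u * (INR k * Cpow X k.-1 * (Cpow Dl h + X * Cpow X h.-1) +
    INR l * (Cpow X k * Cpow X h.-1)) / (Cpow Dl (k + l)%nat * Cpow Dl h))%C.
  have -> : (Cpow X k * (- (INR (k + l)%nat * Cpow Dl (k + l).-1 *
      - (u * Cpow X h.-1 * Dl / Cpow Dl h)) / (Cpow Dl (k + l)%nat * Cpow Dl (k + l)%nat)) =
     (INR k * Cpow X k + INR l * Cpow X k) * (u * Cpow X h.-1) / (Cpow Dl (k + l)%nat * Cpow Dl h))%C.
    transitivity (Cpow X k * (u * Cpow X h.-1) * (INR (k + l)%nat * Cpow Dl (k + l).-1 * Dl)
       / (Cpow Dl (k + l)%nat * Cpow Dl (k + l)%nat * Cpow Dl h))%C.
      by field; split.
    rewrite Cpow_pred_mul plus_INR RtoC_plus; field; split=> //.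
  by rewrite -Cpow_pred_mul; field; split.
have -> : (Cpow Dl h + X * Cpow X h.-1 = 1)%C.
  by rewrite DlE {1}hS Cpow_S; ring.
have XE : (Cpow X k * Cpow X h.-1 = Cpow X (a - 1)%nat * Cpow X (k + (b + s))%nat)%C.
  by rewrite -!Cpow_add_r; congr Cpow; rewrite /h; lia.
rewrite XE DhE.
have [k0|k_gt0] := posnP k; have [l0|l_gt0] := posnP l.
- have -> : RtoC (INR k) = 0 by rewrite k0.
  have -> : RtoC (INR l) = 0 by rewrite l0.
  by field; do ! split.
- have b_le : (b <= l)%nat by apply: dvdn_leq.
  rewrite (_ : (k + (b + s) + (l - b) = k + l + s)%nat); last by lia.
  have -> : RtoC (INR k) = 0 by rewrite k0.
  by rewrite (Cpow_add_r Dl (k + l)%nat); field; do ! split.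
- have a_le : (a <= k)%nat by apply: dvdn_leq.
  rewrite (_ : (k - a + (l + (a + s)) = k + l + s)%nat); last by lia.
  have -> : RtoC (INR l) = 0 by rewrite l0.
  rewrite (_ : k.-1 = (a - 1 + (k - a))%nat); last by lia.
  by rewrite (Cpow_add_r X (a - 1)%nat) (Cpow_add_r Dl (k + l)%nat); field; do ! split.
have b_le : (b <= l)%nat by apply: dvdn_leq.
have a_le : (a <= k)%nat by apply: dvdn_leq.
rewrite (_ : (k + (b + s) + (l - b) = k + l + s)%nat); last by lia.
rewrite (_ : (k - a + (l + (a + s)) = k + l + s)%nat); last by lia.
rewrite (_ : k.-1 = (a - 1 + (k - a))%nat); last by lia.
rewrite (Cpow_add_r X (a - 1)%nat) (Cpow_add_r Dl (k + l)%nat).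
by field; do ! split.
Qed.

(** Absorbs the factor N + 1 = (N + 1)! / N! left in the remainder of the Taylor sums. *)
Lemma half_pow_beats_linear N : INR N.+1 * (/ 4) ^ N <= (/ 2) ^ N.
Proof.
have le2 : INR N.+1 <= 2 ^ N.
  elim: N => [|N IHN]; first by rewrite /=; lra.
  have := pos_INR N; rewrite S_INR -[2 ^ N.+1]/(2 * 2 ^ N).
  by rewrite S_INR in IHN *; lra.
have -> : (/ 2) ^ N = 2 ^ N * (/ 4) ^ N by rewrite -Rpow_mult_distr; congr pow; lra.
by apply: Rmult_le_compat_r le2; apply: pow_le; lra.
Qed.

Variables (a b s : nat).
Hypotheses (a_gt0 : (0 < a)%nat) (b_gt0 : (0 < b)%nat) (s_gt0 : (0 < s)%nat).

Local Notation h := (a + b + s)%nat.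

Let h_gt0 : (0 < h)%nat. Proof. by rewrite -addnA ltn_addr. Qed.

Lemma Re_one_sub_pow_gt0 v : Cmod v < 1 -> 0 < Re (1 - Cpow v h)%C.
Proof.
move=> v_lt1; have : Cmod (Cpow v h) < 1.
  rewrite Cmod_pow; apply: (proj2 (pow_lt_1_compat _ _ _ _)); last exact/ltP.
  by split; first exact: Cmod_ge_0.
have := re_le_Cmod (Cpow v h); have := Rle_abs (Re (Cpow v h)).
by rewrite /Cminus /Cplus /Copp /=; rewrite /Re; lra.
Qed.

Lemma delta_pow v : Cmod v < 1 -> Cpow (delta a b s v) h = (1 - Cpow v h)%C.
Proof. by move=> v_lt1; apply: Croot_pow => //; apply: Re_one_sub_pow_gt0. Qed.

Lemma delta_neq0 v : delta a b s v <> 0.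
Proof. exact: Croot_neq0. Qed.

(** The derivative of x |-> Iint (x u), hence the factor u of the chain rule. *)
Definition kernel_seg (u : C) (x : R) : C :=
  (u * (Cpow (x * u) (a - 1)%nat / Cpow (delta a b s (x * u)) (a + b)%nat))%C.

Lemma is_Cderive_line (u : C) x : is_Cderive (fun y => y * u)%C x u.
Proof.
split.
  apply: (is_derive_ext (fun y => y * Re u)) => [y|]; first by rewrite /Re /=; ring.
  by auto_derive => //; ring.
apply: (is_derive_ext (fun y => y * Im u)) => [y|]; first by rewrite /Im /=; ring.
by auto_derive => //; ring.
Qed.

Lemma is_Cderive_delta (u : C) (x : R) : Cmod (x * u) < 1 ->
  is_Cderive (fun y => delta a b s (y * u)) x
   (- (u * Cpow (x * u) h.-1 * delta a b s (x * u) / Cpow (delta a b s (x * u)) h))%C.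
Proof.
move=> xu_lt1; have h_neq0 : INR h <> 0 by apply: not_0_INR; move: (h_gt0); clear; lia.
have dw : is_Cderive (fun y => 1 - Cpow (y * u) h)%C x (- (INR h * Cpow (x * u) h.-1 * u))%C.
  have d1 := is_Cderive_scal (- 1) (is_Cderive_pow h (is_Cderive_line u x)).
  apply: is_Cderive_ext (is_Cderive_eq (is_Cderive_plus (is_Cderive_const 1 x) d1) _).
    by move=> y; ring.
  by ring.
apply: is_Cderive_eq (is_Cderive_Croot h_gt0 (Re_one_sub_pow_gt0 xu_lt1) dw) _.
rewrite delta_pow // -/(delta a b s (x * u)%C) RtoC_inv //.
have w_neq0 : (1 - Cpow (x * u) h)%C <> 0.
  by rewrite -delta_pow //; apply/Cpow_nz/delta_neq0.
field; split=> //; by move=> /RtoC_inj.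
Qed.

Lemma ex_Cderive_kernel_seg (u : C) (x : R) : Cmod (x * u) < 1 -> exists l, is_Cderive (kernel_seg u) x l.
Proof.
move=> xu_lt1; eexists; apply: is_Cderive_scal.
apply: is_Cderive_mult; first exact/is_Cderive_pow/is_Cderive_line.
apply: is_Cderive_inv; first exact/Cpow_nz/delta_neq0.
exact/is_Cderive_pow/is_Cderive_delta.
Qed.

Lemma Cmod_between (u : C) (x t : R) : Cmod (x * u) < 1 -> Rmin 0 x <= t <= Rmax 0 x -> Cmod (t * u) < 1.
Proof.
rewrite !Cmod_mult !Cmod_R => xu_lt1 t_in; apply: Rle_lt_trans xu_lt1.
apply: Rmult_le_compat_r; first exact: Cmod_ge_0.
move: t_in; rewrite /Rmin /Rmax /Rabs.
by case: Rle_dec; case: Rcase_abs; case: Rcase_abs; lra.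
Qed.

Lemma is_RInt_kernel_seg (u : C) (x : R) : Cmod (x * u) < 1 ->
  is_RInt (V := R_NormedModule) (fun t => Re (kernel_seg u t)) 0 x
    (RInt (fun t => Re (kernel_seg u t)) 0 x) /\
  is_RInt (V := R_NormedModule) (fun t => Im (kernel_seg u t)) 0 x
    (RInt (fun t => Im (kernel_seg u t)) 0 x).
Proof.
move=> xu_lt1; split; apply: (@RInt_correct R_CompleteNormedModule);
  apply: ex_RInt_continuous => t /(Cmod_between xu_lt1) /ex_Cderive_kernel_seg [l [dr di]].
  by apply: (@ex_derive_continuous R_AbsRing R_NormedModule); eexists; exact: dr.
by apply: (@ex_derive_continuous R_AbsRing R_NormedModule); eexists; exact: di.
Qed.

(** Rescaling the unit interval to [0, x] moves x from the integrand to the endpoint, where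
    the fundamental theorem of calculus applies. *)
Lemma Iint_seg u (x : R) : Cmod (x * u) < 1 ->
  Iint a b s (x * u) = (RInt (fun t => Re (kernel_seg u t)) 0 x,
                        RInt (fun t => Im (kernel_seg u t)) 0 x).
Proof.
move=> /is_RInt_kernel_seg [Ir Ii].
apply: (@is_RInt_unique C_R_CompleteNormedModule).
have I := @is_RInt_fct_extend_pair R_NormedModule R_NormedModule (kernel_seg u) 0 x _ _ Ir Ii.
have := @is_RInt_comp_lin C_R_NormedModule (kernel_seg u) x 0 0 1.
rewrite Rmult_0_r Rplus_0_r Rmult_1_r Rplus_0_r => /(_ _ I).
apply: is_RInt_ext => t _; rewrite /kernel_seg Rplus_0_r.
have -> : (RtoC (x * t) * u = t * (x * u))%C by rewrite RtoC_mult; ring.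
rewrite scal_R_Cmult; exact: Cmult_assoc.
Qed.

Lemma Cmod_line_open (u : C) (x : R) : Cmod (x * u) < 1 ->
  locally x (fun y : R => Cmod (y * u) < 1).
Proof.
rewrite Cmod_mult Cmod_R => xu_lt1; have u_ge0 := Cmod_ge_0 u.
have e_gt0 : 0 < (1 - Rabs x * Cmod u) / (Cmod u + 1) by apply: Rdiv_lt_0_compat; lra.
exists (mkposreal _ e_gt0) => y.
rewrite /ball /= /AbsRing_ball /= /abs /minus /plus /opp /= => yx.
rewrite Cmod_mult Cmod_R.
have y_le : Rabs y <= Rabs x + Rabs (y + - x).
  by have := Rabs_triang x (y - x); rewrite Rplus_minus.
have : Rabs (y + - x) * (Cmod u + 1) < 1 - Rabs x * Cmod u.
  have u1_gt0 : 0 < Cmod u + 1 by lra.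
  have := Rmult_lt_compat_r _ _ _ u1_gt0 yx.
  by rewrite (_ : (1 - _) / _ * _ = 1 - Rabs x * Cmod u) //; field; lra.
have := Rabs_pos (y + - x); nra.
Qed.

Lemma is_Cderive_Iint (u : C) (x : R) : Cmod (x * u) < 1 ->
  is_Cderive (fun y => Iint a b s (y * u)) x (kernel_seg u x).
Proof.
move=> xu_lt1; have near_x := Cmod_line_open xu_lt1.
have [l [cr ci]] := ex_Cderive_kernel_seg xu_lt1.
split.
  apply: (is_derive_ext_loc (fun y => RInt (fun t => Re (kernel_seg u t)) 0 y)).
    by apply: filter_imp near_x => y yu_lt1; rewrite Iint_seg.
  apply: (is_derive_RInt (fun t => Re (kernel_seg u t)) _ 0); last first.
    by apply: (@ex_derive_continuous R_AbsRing R_NormedModule); eexists; exact: cr.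
  by apply: filter_imp near_x => y yu_lt1; case: (is_RInt_kernel_seg yu_lt1).
apply: (is_derive_ext_loc (fun y => RInt (fun t => Im (kernel_seg u t)) 0 y)).
  by apply: filter_imp near_x => y yu_lt1; rewrite Iint_seg.
apply: (is_derive_RInt (fun t => Im (kernel_seg u t)) _ 0); last first.
  by apply: (@ex_derive_continuous R_AbsRing R_NormedModule); eexists; exact: ci.
by apply: filter_imp near_x => y yu_lt1; case: (is_RInt_kernel_seg yu_lt1).
Qed.

Lemma Iint0 : Iint a b s 0 = 0.
Proof.
have zero_lt1 : Cmod (0%R * 0) < 1 by rewrite Cmult_0_l Cmod_0; lra.
have := Iint_seg zero_lt1; rewrite Cmult_0_l => ->.
by rewrite !RInt_point.
Qed.

(** The n-th derivative of psi at I(v), for the urn started from st. *)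
Definition flow_coef (st : nat * nat) (n : nat) (v : C) : C :=
  (history_sum a b s st n v / Cpow (delta a b s v) (balls st + s * n))%C.

(** Both successor compositions contain s more balls, so they need the same power of delta
    as the left-hand side. *)
Lemma flow_coefS st n v : tenable a b s st.1 st.2 ->
  flow_coef st n.+1 v =
  (INR st.1 * flow_coef (st.1 - a, st.2 + (a + s))%nat n v +
   INR st.2 * flow_coef (st.1 + (b + s), st.2 - b)%nat n v)%C.
Proof.
case: st => k l /and4P[/= ak bl _ _].
rewrite /flow_coef history_sumS /balls /=.
have neq0 m : Cpow (delta a b s v) m <> 0 by apply/Cpow_nz/delta_neq0.
have blackE : INR k <> 0 -> (k - a + (l + (a + s)) + s * n = k + l + s * n.+1)%nat.
  move=> k_neq0; have : (a <= k)%nat by apply: dvdn_leq => //; case: (k) k_neq0.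
  by lia.
have whiteE : INR l <> 0 -> (k + (b + s) + (l - b) + s * n = k + l + s * n.+1)%nat.
  move=> l_neq0; have : (b <= l)%nat by apply: dvdn_leq => //; case: (l) l_neq0.
  by lia.
have [k0|/[dup] k0 /blackE ->] := Req_dec (INR k) 0;
have [l0|/[dup] l0 /whiteE ->] := Req_dec (INR l) 0; rewrite ?k0 ?l0; field=> //.
all: by split.
Qed.

Lemma tenable_black k l : tenable a b s k l -> (0 < k)%nat ->
  tenable a b s (k - a) (l + (a + s)).
Proof.
move=> ten k_gt0.
by have [] := @tenable_step a b s (k, l) 0 ten; rewrite /balls /urn_step ?k_gt0 //= ltn_addr.
Qed.

Lemma tenable_white k l : tenable a b s k l -> (0 < l)%nat ->
  tenable a b s (k + (b + s)) (l - b).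
Proof.
move=> ten l_gt0.
by have [] := @tenable_step a b s (k, l) k ten; rewrite /balls /urn_step ?ltnn //= -addn1 leq_add2l.
Qed.

(** Differentiation with respect to I(v) shifts n: the coefficients in [flow_coefS] are
    constants, so the property is inherited from the case n = 0. *)
Lemma flow_coef_derive n st (u : C) (x : R) :
  tenable a b s st.1 st.2 -> Cmod (x * u) < 1 ->
  is_Cderive (fun y => flow_coef st n (y * u)) x
    (kernel_seg u x * flow_coef st n.+1 (x * u))%C.
Proof.
move=> + xu_lt1; elim: n st => [|n IHn] [k l] ten; last first.
  apply: is_Cderive_ext (fun y => esym (flow_coefS _ _ ten)) _.
  rewrite (flow_coefS _ _ ten) /=.
  have dk : is_Cderive (fun y => INR k * flow_coef (k - a, l + (a + s))%nat n (y * u))%C x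
      (INR k * (kernel_seg u x * flow_coef (k - a, l + (a + s))%nat n.+1 (x * u)))%C.
    have [->|k_gt0] := posnP k.
      rewrite Cmult_0_l; apply: is_Cderive_ext (is_Cderive_const 0 x) => y.
      by rewrite Cmult_0_l.
    by apply: is_Cderive_scal; apply: IHn; apply: tenable_black.
  have dl : is_Cderive (fun y => INR l * flow_coef (k + (b + s), l - b)%nat n (y * u))%C x
      (INR l * (kernel_seg u x * flow_coef (k + (b + s), l - b)%nat n.+1 (x * u)))%C.
    have [->|l_gt0] := posnP l.
      rewrite Cmult_0_l; apply: is_Cderive_ext (is_Cderive_const 0 x) => y.
      by rewrite Cmult_0_l.
    by apply: is_Cderive_scal; apply: IHn; apply: tenable_white.
  by apply: is_Cderive_eq (is_Cderive_plus dk dl) _; ring.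
have sum0 st v : flow_coef st 0 v = (Cpow v st.1 * / Cpow (delta a b s v) (balls st))%C.
  by rewrite /flow_coef /history_sum big_seq1 muln0 addn0.
apply: is_Cderive_ext (fun y => esym (sum0 _ _)) _.
have neq0 m : Cpow (delta a b s (x * u)) m <> 0 by apply/Cpow_nz/delta_neq0.
have := is_Cderive_mult (is_Cderive_pow k (is_Cderive_line u x))
  (is_Cderive_inv (neq0 _) (is_Cderive_pow (balls (k, l)) (is_Cderive_delta xu_lt1))).
move=> /is_Cderive_eq; apply.
rewrite (flow_coefS _ _ ten) !sum0 /kernel_seg /balls /=.
apply: (flow_base_identity u a_gt0 ten); first exact: delta_neq0.
exact: delta_pow.
Qed.

(** If the modulus of delta left [1/2, 2], so would that of its power delta^h = 1 - v^h. *)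
Lemma Cmod_delta_bounds v : Cmod v <= / 2 -> / 2 <= Cmod (delta a b s v) <= 2.
Proof.
move=> v_le; have v_lt1 : Cmod v < 1 by lra.
have hS : (a + b + s = (a + b + s).-1.+1)%nat by rewrite prednK // -addnA ltn_addr.
have := f_equal Cmod (delta_pow v_lt1); rewrite Cmod_pow.
set w := (1 - _)%C => DlE.
have vh_le : Cmod (Cpow v (a + b + s)%nat) <= / 2.
  rewrite hS Cpow_S Cmod_mult Cmod_pow.
  have v_ge0 := Cmod_ge_0 v.
  have : Cmod v ^ (a + b + s).-1 <= 1 by rewrite -(pow1 (a + b + s).-1); apply: pow_incr; lra.
  by have := pow_le _ (a + b + s).-1 v_ge0; nra.
have [w_ge w_le] : / 2 <= Cmod w <= 2.
  have := Cmod_triangle w (Cpow v (a + b + s)%nat).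
  rewrite /w (_ : (1 - _ + _)%C = 1%C); last by ring.
  have := Cmod_triangle 1 (- Cpow v (a + b + s)%nat)%C; rewrite Cmod_opp Cmod_1 -/w.
  by rewrite -/(Cminus _ _) -/w; lra.
have D_ge0 := Cmod_ge_0 (delta a b s v).
move: DlE; rewrite hS /= => DlE; split; apply: Rnot_lt_le => lt.
  have : Cmod (delta a b s v) ^ (a + b + s).-1 <= 1.
    by rewrite -(pow1 (a + b + s).-1); apply: pow_incr; lra.
  by nra.
have : 1 <= Cmod (delta a b s v) ^ (a + b + s).-1 by apply: pow_R1_Rle; lra.
by nra.
Qed.

Lemma Cmod_inv_delta_pow v m : Cmod v <= / 2 -> Cmod (/ Cpow (delta a b s v) m) <= 2 ^ m.
Proof.
move=> /Cmod_delta_bounds [D_ge _].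
rewrite Cmod_inv; last exact/Cpow_nz/delta_neq0.
rewrite Cmod_pow -pow_inv; apply: pow_incr; split.
  by apply/Rlt_le/Rinv_0_lt_compat; lra.
by rewrite -[X in _ <= X]Rinv_inv; apply: Rinv_le_contravar; lra.
Qed.

Lemma Cmod_kernel_seg (u : C) (x : R) : Cmod (x * u) <= / 2 ->
  Cmod (kernel_seg u x) <= Cmod u * 2 ^ (a + b).
Proof.
move=> xu_le; rewrite /kernel_seg !Cmod_mult; apply: Rmult_le_compat_l; first exact: Cmod_ge_0.
rewrite -[X in _ <= X]Rmult_1_l; apply: Rmult_le_compat; try exact: Cmod_ge_0.
  rewrite Cmod_pow -(pow1 (a - 1)); apply: pow_incr; split; first exact: Cmod_ge_0.
  by lra.
exact: Cmod_inv_delta_pow.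
Qed.

Lemma Cmod_Iint (u : C) : Cmod u <= / 2 -> Cmod (Iint a b s u) <= 2 * (Cmod u * 2 ^ (a + b)).
Proof.
move=> u_le; have := @Cmod_increment_le (fun x => Iint a b s (x * u)) (kernel_seg u)
  (Cmod u * 2 ^ (a + b)).
rewrite Cmult_1_l Cmult_0_l Iint0 (_ : (_ - 0)%C = Iint a b s u); last by ring.
apply=> x x_in; have xu_le := Cmod_scale_le x_in u_le.
  by apply: is_Cderive_Iint; lra.
exact: Cmod_kernel_seg.
Qed.

Lemma Cmod_flow_coef st n v : tenable a b s st.1 st.2 -> Cmod v <= / 2 ->
  Cmod (flow_coef st n v) <= INR (balls st + s) ^ n * INR n`! * 2 ^ (balls st + s * n).
Proof.
move=> ten v_le; rewrite /flow_coef Cmod_mult; apply: Rmult_le_compat; try exact: Cmod_ge_0.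
  apply: Rle_trans (Cmod_history_sum _ _ _ _ _ _) _; first lra.
  exact: size_histories_le.
exact: Cmod_inv_delta_pow.
Qed.

(** The Taylor sum at c of the function whose derivatives at I(x u) are the [flow_coef]. *)
Definition flow_taylor (st : nat * nat) (c u : C) (N : nat) (x : R) : C :=
  sum_n (G := C_AbelianGroup)
    (fun n => flow_coef st n (x * u) * (Cpow (c - Iint a b s (x * u)) n / INR n`!))%C N.

(** The derivative of each factor (c - I)^n / n! cancels the contribution of the preceding
    coefficient; only the last coefficient leaves a term. *)
Lemma flow_taylor_derive st c (u : C) N (x : R) : tenable a b s st.1 st.2 -> Cmod (x * u) < 1 ->
  is_Cderive (flow_taylor st c u N) x
    (kernel_seg u x * flow_coef st N.+1 (x * u) *
      (Cpow (c - Iint a b s (x * u)) N / INR N`!))%C.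
Proof.
move=> ten xu_lt1.
have de : is_Cderive (fun y => c - Iint a b s (y * u))%C x (- kernel_seg u x)%C.
  have dI := is_Cderive_scal (- 1) (is_Cderive_Iint xu_lt1).
  apply: is_Cderive_ext (is_Cderive_eq (is_Cderive_plus (is_Cderive_const c x) dI) _).
    by move=> y; ring.
  by ring.
elim: N => [|N IHN].
  apply: is_Cderive_ext (is_Cderive_eq (flow_coef_derive 0 ten xu_lt1) _).
    by move=> y; rewrite /flow_taylor sum_O /=; field; move=> /RtoC_inj.
  by rewrite /=; field; move=> /RtoC_inj.
have fact_neq0 m : RtoC (INR m`!) <> 0.
  by move=> /RtoC_inj; apply: not_0_INR; have := fact_gt0 m; case: (m`!).
have S_neq0 : RtoC (INR N + 1) <> 0 by move=> /RtoC_inj; have := pos_INR N; lra.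
apply: is_Cderive_ext (is_Cderive_eq (is_Cderive_plus IHN (is_Cderive_mult
  (flow_coef_derive N.+1 ten xu_lt1)
  (is_Cderive_mult (is_Cderive_pow N.+1 de) (is_Cderive_const (/ INR N.+1`!) x)))) _).
  by move=> y; rewrite /flow_taylor sum_Sn.
rewrite factS mult_INR RtoC_mult S_INR -pred_Sn Cpow_S.
by field; split.
Qed.

Lemma delta0 : delta a b s 0 = 1.
Proof.
have h_neq0 : (a + b + s)%nat = (a + b + s).-1.+1 by rewrite prednK // -addnA ltn_addr.
rewrite /delta h_neq0 Cpow_S Cmult_0_l (_ : (1 - 0)%C = 1%C); last by ring.
rewrite /Croot Cmod_1 /= /Rdiv Rmult_0_l atan_0 Rmult_0_l cos_0 sin_0.
by rewrite /Rpower ln_1 Rmult_0_r exp_0; apply: Cmult_1_l.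
Qed.

Definition history_coef (st : nat * nat) (u : C) (n : nat) : C :=
  (history_sum a b s st n u / INR n`!)%C.

Lemma flow_taylor0 st c u N :
  flow_taylor st c u N 0 =
  sum_n (G := C_AbelianGroup) (fun n => Cpow c n * history_coef st 0 n)%C N.
Proof.
apply: Csum_ext => n; rewrite Cmult_0_l Iint0 // /flow_coef delta0 Cpow_1_l /history_coef.
rewrite (_ : (c - 0)%C = c); last by ring.
by field; move=> /RtoC_inj; apply: not_0_INR; have := fact_gt0 n; case: (n`!).
Qed.

Lemma flow_taylor1 st z (u : C) N :
  (Cpow (delta a b s u) (balls st) *
    flow_taylor st (z * Cpow (delta a b s u) s + Iint a b s u) u N 1)%C =
  sum_n (G := C_AbelianGroup) (fun n => Cpow z n * history_coef st u n)%C N.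
Proof.
rewrite /flow_taylor.
have -> : (Cpow (delta a b s u) (balls st) * sum_n (G := C_AbelianGroup) (fun n =>
    flow_coef st n (1 * u) *
    (Cpow (z * Cpow (delta a b s u) s + Iint a b s u - Iint a b s (1 * u)) n / INR n`!))%C N)%C =
    sum_n (G := C_AbelianGroup) (fun n => Cpow (delta a b s u) (balls st) *
     (flow_coef st n (1 * u) *
    (Cpow (z * Cpow (delta a b s u) s + Iint a b s u - Iint a b s (1 * u)) n / INR n`!)))%C N.
  elim: N => [|N IHN]; first by rewrite !sum_O.
  by rewrite !sum_Sn -IHN /plus /=; ring.
apply: Csum_ext => n; rewrite Cmult_1_l.
rewrite (_ : (_ + _ - _)%C = (z * Cpow (delta a b s u) s)%C); last by ring.
have powM : Cpow (delta a b s u) (s * n)%nat = Cpow (Cpow (delta a b s u) s) n.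
  exact: Cpow_mult_r.
rewrite /flow_coef /history_coef (Cpow_add_r _ (balls st)) powM Cpow_mult_l.
have neq0 m : Cpow (delta a b s u) m <> 0 by apply/Cpow_nz/delta_neq0.
field; do ! split=> //; last exact: Cpow_nz.
by move=> /RtoC_inj; apply: not_0_INR; have := fact_gt0 n; case: (n`!).
Qed.

(** Geometric decay: with K = (t + s) 2^s the derivative of the N-th Taylor sum is of order
    (N + 1) (eps K)^N, and eps K is at most 1/4. *)
Lemma flow_taylor_increment st c (u : C) N eps :
  tenable a b s st.1 st.2 -> Cmod u <= / 2 ->
  eps * (4 * (INR (balls st + s) * 2 ^ s)) <= 1 ->
  (forall x : R, 0 <= x <= 1 -> Cmod (c - Iint a b s (x * u))%C <= eps) ->
  Cmod (flow_taylor st c u N 1 - flow_taylor st c u N 0)%C <=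
  2 * (2 ^ (a + b) * 2 ^ balls st * (INR (balls st + s) * 2 ^ s) * (/ 2) ^ N).
Proof.
move=> ten u_le eps_le e_le; set K := INR (balls st + s) * 2 ^ s in eps_le *.
have K_ge0 : 0 <= K by apply: Rmult_le_pos; [exact: pos_INR | apply: pow_le; lra].
apply: Cmod_increment_le => x x_in.
  have xu_le := Cmod_scale_le x_in u_le.
  by apply: flow_taylor_derive => //; lra.
have xu_le := Cmod_scale_le x_in u_le.
have fact_gt0 : 0 < INR N`! by apply: lt_0_INR; apply/ltP; exact: fact_gt0.
have eps_ge0 : 0 <= eps by apply: Rle_trans (Cmod_ge_0 _) (e_le x x_in).
have term_le : Cmod (Cpow (c - Iint a b s (x * u)) N / INR N`!)%C <= eps ^ N / INR N`!.
  rewrite Cmod_div; last by move=> /RtoC_inj; lra.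
  rewrite Cmod_R (Rabs_pos_eq (INR _)); last lra.
  apply: Rmult_le_compat_r; first exact/Rlt_le/Rinv_0_lt_compat.
  by rewrite Cmod_pow; apply: pow_incr; split; [exact: Cmod_ge_0 | exact: e_le].
rewrite 2!Cmod_mult.
have k_le : Cmod (kernel_seg u x) <= 2 ^ (a + b).
  apply: Rle_trans (Cmod_kernel_seg xu_le) _.
  have : 0 < 2 ^ (a + b) by apply: pow_lt; lra.
  by have := Cmod_ge_0 u; nra.
have := Rmult_le_compat _ _ _ _ (Rmult_le_pos _ _ (Cmod_ge_0 _) (Cmod_ge_0 _)) (Cmod_ge_0 _)
  (Rmult_le_compat _ _ _ _ (Cmod_ge_0 _) (Cmod_ge_0 _) k_le
    (Cmod_flow_coef N.+1 ten xu_le)) term_le.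
move=> /Rle_trans; apply.
have -> : 2 ^ (a + b) * (INR (balls st + s) ^ N.+1 * INR N.+1`! * 2 ^ (balls st + s * N.+1)) *
   (eps ^ N / INR N`!) = 2 ^ (a + b) * 2 ^ balls st * K * (INR N.+1 * (eps * K) ^ N).
  have powM : 2 ^ (s * N.+1)%nat = (2 ^ s) ^ N.+1 by exact: pow_mult.
  rewrite factS mult_INR (pow_add _ (balls st)) powM /K !Rpow_mult_distr.
  rewrite -[_ ^ N.+1]/(INR (balls st + s) * INR (balls st + s) ^ N) -[_ ^ N.+1]/(2 ^ s * (2 ^ s) ^ N).
  by field; lra.
apply: Rmult_le_compat_l.
  by apply: Rmult_le_pos => //; apply: Rmult_le_pos; apply: pow_le; lra.
apply: Rle_trans (half_pow_beats_linear N); apply: Rmult_le_compat_l; first exact: pos_INR.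
by apply: pow_incr; split; [exact: Rmult_le_pos | lra].
Qed.

(** At the end x = 0 of the segment the Taylor sums are those of the series at c, at the end
    x = 1 those of the generating function in z.  The bound eta lets c be placed inside any
    given disc. *)
Lemma flow_series st (eta : R) : tenable a b s st.1 st.2 -> 0 < eta ->
  exists r : R, 0 < r /\ forall z u : C, Cmod z < r -> Cmod u < r ->
    let c := (z * Cpow (delta a b s u) s + Iint a b s u)%C in
    Cmod c < eta /\
    forall l, @is_pseries C_AbsRing C_NormedModule (history_coef st 0) c l ->
      @is_pseries C_AbsRing C_NormedModule (history_coef st u) z
        (Cpow (delta a b s u) (balls st) * l)%C.
Proof.
move=> ten eta_gt0.
pose K := INR (balls st + s) * 2 ^ s.
have K_gt0 : 0 < K.
  apply: Rmult_lt_0_compat; last by apply: pow_lt; lra.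
  by apply: lt_0_INR; apply/ltP; rewrite addn_gt0 s_gt0 orbT.
pose eps := Rmin (/ (4 * K)) (eta / 2).
have eps_gt0 : 0 < eps by apply: Rmin_glb_lt; [apply: Rinv_0_lt_compat; lra | lra].
have eps_le : eps * (4 * K) <= 1.
  have K4_ge0 : 0 <= 4 * K by lra.
  have := Rmult_le_compat_r _ _ _ K4_ge0 (Rmin_l (/ (4 * K)) (eta / 2)).
  by rewrite -/eps Rinv_l //; lra.
(* Bounds |c - I(x u)| <= B r: the term z delta^s gives 2^s r, and I(u) and I(x u) give
   2 * 2^(a+b) r each. *)
pose B := 2 ^ s + 4 * 2 ^ (a + b).
have s2_gt0 : 0 < 2 ^ s by apply: pow_lt; lra.
have ab2_gt0 : 0 < 2 ^ (a + b) by apply: pow_lt; lra.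
have B_gt0 : 0 < B by rewrite /B; lra.
pose r := Rmin (/ 2) (eps / B).
have r_gt0 : 0 < r by apply: Rmin_glb_lt; [lra | apply: Rdiv_lt_0_compat].
have r_le : r <= / 2 by apply: Rmin_l.
have rB_le : r * B <= eps.
  have := Rmult_le_compat_r _ _ _ (Rlt_le _ _ B_gt0) (Rmin_r (/ 2) (eps / B)).
  by rewrite -/r (_ : eps / B * B = eps) //; field; lra.
exists r; split=> // z u z_lt u_lt c.
have u_le : Cmod u <= / 2 by lra.
have c_le (x : R) : 0 <= x <= 1 -> Cmod (c - Iint a b s (x * u))%C <= eps.
  move=> x_in; have xu_le := Cmod_scale_le x_in (Rlt_le _ _ u_lt).
  have [_ D_le] := Cmod_delta_bounds u_le.
  have zD : Cmod (z * Cpow (delta a b s u) s)%C <= r * 2 ^ s.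
    rewrite Cmod_mult Cmod_pow; apply: Rmult_le_compat; try lra; first exact: Cmod_ge_0.
      by apply: pow_le; exact: Cmod_ge_0.
    by apply: pow_incr; split; first exact: Cmod_ge_0.
  have Iu := Cmod_Iint u_le.
  have Ixu := Cmod_Iint (Rle_trans _ _ _ xu_le r_le).
  apply: Rle_trans (Cmod_triangle _ _) _; rewrite Cmod_opp.
  have := Cmod_triangle (z * Cpow (delta a b s u) s)%C (Iint a b s u).
  have : Cmod u * 2 ^ (a + b) <= r * 2 ^ (a + b) by apply: Rmult_le_compat_r; lra.
  have : Cmod (x * u) * 2 ^ (a + b) <= r * 2 ^ (a + b) by apply: Rmult_le_compat_r; lra.
  by rewrite -/c; move: rB_le; rewrite /B; lra.
split.
  have zero_in : 0 <= 0 <= 1 by lra.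
  have := c_le 0 zero_in; rewrite Cmult_0_l Iint0 // (_ : (c - 0)%C = c); last by ring.
  by have := Rmin_r (/ (4 * K)) (eta / 2); rewrite -/eps; lra.
move=> l /is_pseries_Cmod lim0; apply/is_pseries_Cmod.
pose Dt := Cmod (Cpow (delta a b s u) (balls st)).
pose M := 2 * (2 ^ (a + b) * 2 ^ balls st * K).
apply: (is_lim_seq_le_le (fun=> 0) _ (fun N => Dt * (M * (/ 2) ^ N +
   Cmod (sum_n (G := C_AbelianGroup) (fun k => Cpow c k * history_coef st 0 k)%C N - l)%C))).
- move=> N; split; first exact: Cmod_ge_0.
  rewrite -flow_taylor1 -/c -(flow_taylor0 st c u).
  rewrite (_ : (_ - _)%C = (Cpow (delta a b s u) (balls st) *
     ((flow_taylor st c u N 1 - flow_taylor st c u N 0) +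
     (flow_taylor st c u N 0 - l)))%C); last by ring.
  rewrite Cmod_mult; apply: Rmult_le_compat_l; first exact: Cmod_ge_0.
  apply: Rle_trans (Cmod_triangle _ _) _; apply: Rplus_le_compat_r.
  have := @flow_taylor_increment st c u N eps ten u_le eps_le c_le.
  by rewrite -/K /M; lra.
- exact: is_lim_seq_const.
- rewrite -[X in is_lim_seq _ (Finite X)](_ : Dt * (M * 0 + 0) = 0); last by ring.
  apply: (is_lim_seq_scal_l _ Dt (M * 0 + 0)).
  apply: is_lim_seq_plus' lim0; apply: (is_lim_seq_scal_l _ M 0).
  by apply: is_lim_seq_geom; rewrite Rabs_pos_eq; lra.
Qed.

Lemma history_coef_series st (w : C) : tenable a b s st.1 st.2 ->
  Cmod w < / INR (balls st + s) ->
  exists l, @is_pseries C_AbsRing C_NormedModule (history_coef st 0) w l.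
Proof.
move=> ten w_lt; have A_gt0 : 0 < INR (balls st + s).
  by apply: lt_0_INR; apply/ltP; rewrite addn_gt0 s_gt0 orbT.
apply: (@ex_series_le C_AbsRing C_CompleteNormedModule _
  (fun n => (Cmod w * INR (balls st + s)) ^ n)).
  move=> n; rewrite pow_nE -[norm _]/(Cmod (Cpow w n * history_coef st 0 n)%C).
  rewrite Cmod_mult Cmod_pow Rpow_mult_distr; apply: Rmult_le_compat_l.
    by apply: pow_le; exact: Cmod_ge_0.
  have fact_gt0 : 0 < INR n`! by apply: lt_0_INR; apply/ltP; exact: fact_gt0.
  rewrite /history_coef Cmod_div; last by move=> /RtoC_inj; lra.
  rewrite Cmod_R (Rabs_pos_eq (INR n`!)); last lra.
  apply: (Rmult_le_reg_r (INR n`!)) => //; rewrite /Rdiv Rmult_assoc Rinv_l ?Rmult_1_r; last lra.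
  apply: Rle_trans (Cmod_history_sum _ _ _ _ _ _) (size_histories_le _ ten).
  by rewrite Cmod_0; lra.
apply: ex_series_geom; rewrite Rabs_pos_eq; last first.
  by apply: Rmult_le_pos; [exact: Cmod_ge_0 | lra].
by rewrite -[X in _ < X](Rinv_l (INR (balls st + s))); [apply: Rmult_lt_compat_r | lra].
Qed.

Lemma history_coef0 st u : history_coef st u 0 = Cpow u st.1.
Proof. by rewrite /history_coef /history_sum big_seq1 /=; field; move=> /RtoC_inj; lra. Qed.

Lemma is_pseries_C0 (c : nat -> C) : @is_pseries C_AbsRing C_NormedModule c (RtoC 0) (c 0%nat).
Proof. exact: is_pseries_0. Qed.

(** At z = 0 the generating function reduces to h_0(u) = u^(number of black balls), which
    gives the implicit equation. *)
Lemma flow_psi_exists st : tenable a b s st.1 st.2 -> exists psi : C -> C,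
  is_psi a b s st.1 st.2 psi /\
  forall w : C, Cmod w < / INR (balls st + s) ->
    @is_pseries C_AbsRing C_NormedModule (history_coef st 0) w (psi w).
Proof.
move=> ten; have A_gt0 : 0 < / INR (balls st + s).
  by apply/Rinv_0_lt_compat/lt_0_INR/ltP; rewrite addn_gt0 s_gt0 orbT.
have : forall w, exists l : C, Cmod w < / INR (balls st + s) ->
    @is_pseries C_AbsRing C_NormedModule (history_coef st 0) w l.
  move=> w; have [w_lt|w_ge] := Rlt_le_dec (Cmod w) (/ INR (balls st + s)).
    by have [l cv] := history_coef_series ten w_lt; exists l.
  by exists (RtoC 0) => ?; lra.
move=> /boolp.choice [psi psiP]; exists psi; split=> //.
split; first by exists (history_coef st 0), (/ INR (balls st + s)).
have [r [r_gt0 series]] := flow_series ten A_gt0.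
exists r; split=> // u u_lt.
have zero_lt : Cmod 0 < r by rewrite Cmod_0.
have [] := series (RtoC 0) u zero_lt u_lt; rewrite Cmult_0_l Cplus_0_l => I_lt cv.
have := is_pseries_C_unique (cv _ (psiP _ I_lt)) (@is_pseries_C0 (history_coef st u)).
rewrite history_coef0 => <-.
by rewrite /balls; field; apply/Cpow_nz/delta_neq0.
Qed.

(** For the urn started from a black balls and no white one, psi vanishes at 0 = I(0) but
    takes the value u^a / delta(u)^a at I(u). *)
Lemma Iint_neq0 : (a %| b + s)%nat -> (b %| a + s)%nat ->
  exists r : R, 0 < r /\ forall u : C, u <> 0 -> Cmod u < r -> Iint a b s u <> 0.
Proof.
move=> abs bas; have ten : tenable a b s (a, 0%nat).1 (a, 0%nat).2.
  by apply/and4P; split=> //=.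
have [psi [[_ [r [r_gt0 psiE]]] _]] := flow_psi_exists ten.
exists r; split=> // u u_neq0 u_lt Iu0.
have zero_lt : Cmod 0 < r by rewrite Cmod_0.
have := psiE u u_lt; rewrite Iu0 -(Iint0) (psiE _ zero_lt) /=.
rewrite -(prednK a_gt0) Cpow_S Cmult_0_l prednK // /Cdiv Cmult_0_l => /esym uD0.
have Da_neq0 : Cpow (delta a b s u) (a + 0)%nat <> 0 by apply/Cpow_nz/delta_neq0.
apply: (Cpow_nz u a u_neq0).
by rewrite -[LHS]Cmult_1_r -(Cinv_l _ Da_neq0) Cmult_assoc uD0 Cmult_0_l.
Qed.

(** Two solutions agree at the points I(u), which are nonzero and accumulate at 0. *)
Lemma is_psi_unique (a0 b0 : nat) (psi1 psi2 : C -> C) :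
  (a %| b + s)%nat -> (b %| a + s)%nat ->
  is_psi a b s a0 b0 psi1 -> is_psi a b s a0 b0 psi2 ->
  exists r : R, 0 < r /\ forall w : C, Cmod w < r -> psi1 w = psi2 w.
Proof.
move=> abs bas [[c1 [r1 [r1_gt0 s1]]] [q1 [q1_gt0 e1]]] [[c2 [r2 [r2_gt0 s2]]] [q2 [q2_gt0 e2]]].
have [q [q_gt0 I_neq0]] := Iint_neq0 abs bas.
have r_gt0 : 0 < Rmin r1 r2 by apply: Rmin_glb_lt.
exists (Rmin r1 r2); split=> //.
apply: (pseries_eq_near0 (c1 := c1) (c2 := c2) r_gt0).
- by move=> w w_lt; apply: s1; apply: Rlt_le_trans w_lt (Rmin_l _ _).
- by move=> w w_lt; apply: s2; apply: Rlt_le_trans w_lt (Rmin_r _ _).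
move=> eta eta_gt0.
have B_gt0 : 0 < 2 * 2 ^ (a + b).
  by apply: Rmult_lt_0_compat; [lra | apply: pow_lt; lra].
pose m := Rmin (Rmin q (Rmin q1 q2)) (Rmin (/ 2) (eta / (2 * 2 ^ (a + b)))).
have m_gt0 : 0 < m.
  apply: Rmin_glb_lt; first by apply: Rmin_glb_lt => //; apply: Rmin_glb_lt.
  by apply: Rmin_glb_lt; [lra | apply: Rdiv_lt_0_compat].
have m_le : m <= q /\ m <= q1 /\ m <= q2 /\ m <= / 2 /\ m <= eta / (2 * 2 ^ (a + b)).
  have := Rmin_l (Rmin q (Rmin q1 q2)) (Rmin (/ 2) (eta / (2 * 2 ^ (a + b)))).
  have := Rmin_r (Rmin q (Rmin q1 q2)) (Rmin (/ 2) (eta / (2 * 2 ^ (a + b)))).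
  have := Rmin_l q (Rmin q1 q2); have := Rmin_r q (Rmin q1 q2).
  have := Rmin_l q1 q2; have := Rmin_r q1 q2.
  have := Rmin_l (/ 2) (eta / (2 * 2 ^ (a + b))).
  have := Rmin_r (/ 2) (eta / (2 * 2 ^ (a + b))).
  by rewrite -/m; lra.
have mod_u : Cmod (RtoC (m / 2)) = m / 2 by rewrite Cmod_R Rabs_pos_eq; lra.
exists (Iint a b s (m / 2)%R); split.
- by apply: I_neq0; [move=> /RtoC_inj; lra | rewrite mod_u; lra].
- apply: Rle_lt_trans (Cmod_Iint _) _; rewrite mod_u; first lra.
  have [_ [_ [_ [_ m_le_eta]]]] := m_le.
  have := Rmult_le_compat_r _ _ _ (Rlt_le _ _ B_gt0) m_le_eta.
  rewrite (_ : eta / _ * _ = eta); last by field; lra.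
  by have := Rmult_lt_0_compat _ _ m_gt0 B_gt0; lra.
by rewrite e1 ?e2 //; rewrite mod_u; lra.
Qed.

Lemma urn_bgf_series (a0 b0 : nat) (psi : C -> C) :
  tenable a b s a0 b0 -> is_psi a b s a0 b0 psi ->
  exists r : R, 0 < r /\ forall z u : C, Cmod z < r -> Cmod u < r ->
    @is_pseries C_AbsRing C_NormedModule (urn_bgf a b s a0 b0 u) z
      (Cpow (delta a b s u) (a0 + b0)%nat
         * psi (z * Cpow (delta a b s u) s + Iint a b s u))%C.
Proof.
move=> ten psiP; have /and4P[_ _ abs bas] := ten.
have ten' : tenable a b s (a0, b0).1 (a0, b0).2 by [].
have [psi0 [psi0P psi0_series]] := flow_psi_exists ten'.
have [rho [rho_gt0 psiE]] := is_psi_unique abs bas psiP psi0P.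
have eta_gt0 : 0 < Rmin rho (/ INR (balls (a0, b0) + s)).
  apply: Rmin_glb_lt => //.
  by apply/Rinv_0_lt_compat/lt_0_INR/ltP; rewrite addn_gt0 s_gt0 orbT.
have [r [r_gt0 series]] := flow_series ten' eta_gt0.
exists r; split=> // z u z_lt u_lt.
have [c_lt cv] := series z u z_lt u_lt.
have -> : urn_bgf a b s a0 b0 u = history_coef (a0, b0) u.
  by apply/funext => n; rewrite /urn_bgf history_polyE.
rewrite psiE; last exact: Rlt_le_trans c_lt (Rmin_l _ _).
by apply/cv/psi0_series; apply: Rlt_le_trans c_lt (Rmin_r _ _).
Qed.

End UrnFlow.

Theorem theorem1 (a b s a0 b0 : nat)
    (d : measure_display) (Omega : measurableType d) (P : probability Omega R)
    (D : nat -> {RV P >-> nat})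
    (a_gt0 : (0 < a)%nat) (b_gt0 : (0 < b)%nat) (s_gt0 : (0 < s)%nat)
    (t0_ge1 : (1 <= a0 + b0)%nat)
    (urn_tenable : tenable a b s a0 b0)
    (unifD : uniform_draws a b s (a0, b0) D) :
  let t0 := (a0 + b0)%nat in
  (forall (n : nat) (u : C),
     pgf a b s (a0, b0) D n u =
     Cmult
       (RtoC (Gamma (INR n + 1) * Gamma (INR t0 / INR s)
              / (INR s ^ n * Gamma (INR n + INR t0 / INR s)))%R)
       (urn_bgf a b s a0 b0 u n))
  /\ (exists psi : C -> C, is_psi a b s a0 b0 psi)
  /\ (forall psi : C -> C, is_psi a b s a0 b0 psi ->
      exists r : R, (0 < r)%R /\
        forall z u : C, (Cmod z < r)%R -> (Cmod u < r)%R ->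
          @is_pseries C_AbsRing C_NormedModule (urn_bgf a b s a0 b0 u) z
            (Cpow (delta a b s u) t0
             * psi (z * Cpow (delta a b s u) s + Iint a b s u))%C).
Proof.
move=> t0; have ten : tenable a b s (a0, b0).1 (a0, b0).2 by [].
split; last split.
- move=> n u; pose N := INR (\prod_(j < n) (t0 + s * j))%nat.
  have fact_neq0 : INR n`! <> 0%R by apply: not_0_INR; have := fact_gt0 n; case: (n`!).
  have N_neq0 : N <> 0%R.
    have : (0 < \prod_(j < n) (t0 + s * j))%nat.
      by apply: prodn_gt0 => j; rewrite ltn_addr.
    by rewrite /N => prod_gt0; apply: not_0_INR; case: (\prod_(j < n) _)%nat prod_gt0.
  rewrite Gamma_factor // -/N /urn_bgf history_polyE //.
  transitivity (Cmult (RtoC (Rinv N)) (history_sum a b s (a0, b0) n u)).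
    exact: (pgfE ten unifD t0_ge1).
  rewrite RtoC_div // RtoC_inv //.
  by field; split; move=> /RtoC_inj.
- by have [psi [psiP _]] := flow_psi_exists a_gt0 b_gt0 s_gt0 ten; exists psi.
- by move=> psi; apply: urn_bgf_series.
Qed.
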